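(* Let $n>1$, and let $\mathbb{V}$ be a $1$-dimensional horizontal subgroup of $\mathbb{H}^n$ with complementary vertical subgroup $\mathbb{W}$ (in the coordinates fixed in the context). For every $\eta\in(0,1)$ there exists a constant $C\ge1$ such that the following holds. Let $\phi=(\phi_2,\ldots,\phi_{2n+1}):\mathbb{V}\to\mathbb{W}$ be intrinsic $1$-Lipschitz. Then there exists a coronization $\mathcal{D}=\mathcal{G}\,\dot\cup\,\mathcal{B}$ with constant $C$, with associated forest $\mathcal{F}$, such that for every $\mathcal{T}\in\mathcal{F}$ there is an intrinsic Lipschitz map $$\phi_{\mathcal{T}}=(L_{\mathcal{T}}+\psi_{\mathcal{T}},\phi_{\mathcal{T},2n+1}):\mathbb{V}\to\mathbb{W},$$ where $L_{\mathcal{T}}:\mathbb{R}\to\mathbb{R}^{2n-1}$ is a linear $2$-Lipschitz map and $\psi_{\mathcal{T}}:\mathbb{R}\to\mathbb{R}^{2n-1}$ is an $\eta$-Lipschitz map, such that $$d(\phi(s),\phi_{\mathcal{T}}(s))\le\eta|Q|\quad\text{for all }s\in2Q,\ Q\in\mathcal{T}.$$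
   Context: The $n$-th Heisenberg group $\mathbb{H}^n$ is $\mathbb{R}^{2n+1}$ with the group product $$(x_1,\ldots,x_{2n},t)\cdot(x_1',\ldots,x_{2n}',t')=\Big(x_1+x_1',\ldots,x_{2n}+x_{2n}',\,t+t'+\tfrac12\sum_{i=1}^n (x_ix_{n+i}'-x_i'x_{n+i})\Big),$$ with the metric $d(p,q):=\|q^{-1}\cdot p\|$, where $\|(x,t)\|:=\max\{|x|,\sqrt{|t|}\}$ for $(x,t)\in\mathbb{R}^{2n}\times\mathbb{R}$. Standing convention: $\mathbb{V}=\{(x_1,0,\ldots,0):x_1\in\mathbb{R}\}$ and $\mathbb{W}=\{(0,x_2,\ldots,x_{2n},t)\}$. Points of $\mathbb{V}$ are identified with $s\in\mathbb{R}$ and points of $\mathbb{W}$ with points of $\mathbb{R}^{2n}$, so $\phi=(\phi_2,\ldots,\phi_{2n+1}):\mathbb{R}\to\mathbb{R}^{2n}$, where $\phi_{2n+1}$ is the $t$-component. Every $p\in\mathbb{H}^n$ can be written uniquely as $p=\pi_{\mathbb{V}}(p)\cdot\pi_{\mathbb{W}}(p)$ with $\pi_{\mathbb{V}}(p)\in\mathbb{V}$, $\pi_{\mathbb{W}}(p)\in\mathbb{W}$. A map $\phi:\mathbb{V}\to\mathbb{W}$ is intrinsic $L$-Lipschitz if, with graph map $\Phi(v):=v\cdot\phi(v)$, $\|\pi_{\mathbb{W}}(\Phi(v')^{-1}\cdot\Phi(v))\|\le L\|\pi_{\mathbb{V}}(\Phi(v')^{-1}\cdot\Phi(v))\|$ for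 all $v,v'\in\mathbb{V}$; it is intrinsic Lipschitz if this holds for some $L\ge0$. Lipschitz conditions on maps $\mathbb{R}\to\mathbb{R}^{2n-1}$ are Euclidean. In $d(\phi(s),\phi_{\mathcal{T}}(s))$ the values are regarded as points of $\mathbb{W}\subset\mathbb{H}^n$. $\mathcal{D}$ is the family of standard dyadic intervals of $\mathbb{R}$, $|Q|$ is the length of $Q$, and $2Q$ is the interval with the same midpoint as $Q$ and twice its length. A collection $\mathcal{T}\subset\mathcal{D}$ is a tree if: (T1) it contains a top interval $Q(\mathcal{T})$, i.e. a unique maximal element; (T2) if $Q\in\mathcal{T}$, then $Q'\in\mathcal{T}$ for all dyadic $Q'$ with $Q\subset Q'\subset Q(\mathcal{T})$; (T3) if $Q\in\mathcal{T}$, then either both or neither of the (dyadic) children of $Q$ lie in $\mathcal{T}$. A decomposition $\mathcal{D}=\mathcal{G}\,\dot\cup\,\mathcal{B}$ (disjoint) is a coronization with constant $C$ if (1) $\sum_{Q\in\mathcal{B},\,Q\subset Q_0}|Q|\le C|Q_0|$ for all $Q_0\in\mathcal{D}$; and (2) $\mathcal{G}$ is the disjoint union of a family (forest) $\mathcal{F}$ of trees with $\sum_{\mathcal{T}\in\mathcal{F},\,Q(\mathcal{T})\subset Q_0}|Q(\mathcal{T})|\le C|Q_0|$ for all $Q_0\in\mathcal{D}$. *)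

(* Defs.v *)
From HB Require Import structures.
From mathcomp Require Import all_boot all_order all_algebra.
From mathcomp Require Import all_classical all_reals all_analysis.
From mathcomp Require Import ring lra zify.

Set Implicit Arguments.
Unset Strict Implicit.
Unset Printing Implicit Defensive.

Import Order.TTheory GRing.Theory Num.Theory.

Local Open Scope classical_set_scope.
Local Open Scope ring_scope.

(* The library norm on 'rV[R]_m is the sup norm; the Euclidean one is needed. *)
Definition enorm (R : realType) (m : nat) (x : 'rV[R]_m) : R :=
  Num.sqrt (\sum_(i < m) x 0 i ^+ 2).

Definition elipschitz (R : realType) (m : nat) (L : R) (f : R -> 'rV[R]_m) :=
  forall s s' : R, enorm (f s - f s') <= L * `|s - s'|.

(* A point is (x, t) with x = (x_1, ..., x_2n); x_(i+1) and x_(n+i+1) are the  *)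
(* entries of x at lshift n i and rshift n i, for i : 'I_n.                    *)
Definition heis (R : realType) (n : nat) : Type := ('rV[R]_(n + n) * R)%type.

Definition hmul (R : realType) (n : nat) (p q : heis R n) : heis R n :=
  (p.1 + q.1,
   p.2 + q.2 + 2^-1 *
     \sum_(i < n) (p.1 0 (lshift n i) * q.1 0 (rshift n i)
                   - q.1 0 (lshift n i) * p.1 0 (rshift n i))).

Definition hinv (R : realType) (n : nat) (p : heis R n) : heis R n :=
  (- p.1, - p.2).

Definition hnorm (R : realType) (n : nat) (p : heis R n) : R :=
  Num.max (enorm p.1) (Num.sqrt `|p.2|).

Definition hdist (R : realType) (n : nat) (p q : heis R n) : R :=
  hnorm (hmul (hinv q) p).

(* The point (s, 0, ..., 0) of V. *)
Definition vpt (R : realType) (n : nat) (s : R) : heis R n :=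
  (\row_(i < n + n) (if i == 0 :> nat then s else 0), 0).

(* Coordinates (x_2, ..., x_2n) and t of a point of W. *)
Definition wcoord (R : realType) (n : nat) : Type :=
  ('rV[R]_(n + n).-1 * R)%type.

(* The point (0, x_2, ..., x_2n, t) of W: entry i of the horizontal part is    *)
(* w_j for the j with j + 1 = i, and 0 if i = 0.                               *)
Definition wpt (R : realType) (n : nat) (w : wcoord R n) : heis R n :=
  (\row_(i < n + n) \sum_(j < (n + n).-1 | j.+1 == i :> nat) w.1 0 j, w.2).

(* The components of the decomposition p = piV p . piW p: see hdecomp_exists   *)
(* and hdecomp_uniq below.                                                     *)
Definition piV (R : realType) (n : nat) (p : heis R n) : heis R n :=
  (\row_(i < n + n) (if i == 0 :> nat then p.1 0 i else 0), 0).

Definition piW (R : realType) (n : nat) (p : heis R n) : heis R n :=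
  hmul (hinv (piV p)) p.

Definition graph_map (R : realType) (n : nat) (phi : R -> wcoord R n) (s : R) :
    heis R n :=
  hmul (vpt n s) (wpt (phi s)).

Definition intrinsic_lipschitz (R : realType) (n : nat) (L : R)
    (phi : R -> wcoord R n) :=
  forall s s' : R,
    let p := hmul (hinv (graph_map phi s')) (graph_map phi s) in
    hnorm (piW p) <= L * hnorm (piV p).

(* (k, m) stands for [m 2^k, (m + 1) 2^k[; the encoding is faithful            *)
(* (dset_inj below).                                                           *)
Definition dyadic : Type := (int * int)%type.

Definition dlen (R : realType) (Q : dyadic) : R := 2%:R ^ Q.1.

Definition dset (R : realType) (Q : dyadic) : set R :=
  `[Q.2%:~R * dlen R Q, (Q.2 + 1)%:~R * dlen R Q[.

Arguments dset R Q : clear implicits.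

(* 2Q: same midpoint, twice the length. *)
Definition ddouble (R : realType) (Q : dyadic) : set R :=
  let c := (Q.2%:~R + 2^-1) * dlen R Q in `[c - dlen R Q, c + dlen R Q[.

Arguments ddouble R Q : clear implicits.

Definition child_l (Q : dyadic) : dyadic := (Q.1 - 1, Q.2 * 2).
Definition child_r (Q : dyadic) : dyadic := (Q.1 - 1, Q.2 * 2 + 1).

Definition is_top (R : realType) (T : set dyadic) (Q : dyadic) :=
  T Q /\ forall Q', T Q' -> dset R Q' `<=` dset R Q.

(* Q(T); the default (0, 0) is irrelevant for trees. *)
Definition tree_top (R : realType) (T : set dyadic) : dyadic :=
  xget ((0, 0) : int * int) [set Q | is_top R T Q].

Definition is_tree (R : realType) (T : set dyadic) :=
  [/\ is_top R T (tree_top R T),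
      forall Q Q', T Q -> dset R Q `<=` dset R Q' ->
        dset R Q' `<=` dset R (tree_top R T) -> T Q'
    & forall Q, T Q -> (T (child_l Q) <-> T (child_r Q))].

Definition forest_of (R : realType) (F : set (set dyadic)) (G : set dyadic) :=
  [/\ forall T, F T -> is_tree R T,
      trivIset F id
    & \bigcup_(T in F) T = G].

Definition coronization (R : realType) (C : R) (G B : set dyadic)
    (F : set (set dyadic)) :=
  [/\ G `|` B = setT /\ G `&` B = set0,
      forall Q0 : dyadic,
        (\esum_(Q in [set Q | B Q /\ dset R Q `<=` dset R Q0]) (dlen R Q)%:E
           <= (C * dlen R Q0)%:E)%E,
      forest_of R F G
    & forall Q0 : dyadic,
        (\esum_(T in [set T | F T /\ dset R (tree_top R T) `<=` dset R Q0])
            (dlen R (tree_top R T))%:E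
           <= (C * dlen R Q0)%:E)%E].

Lemma hdecomp_uniq (R : realType) (n : nat) (p : heis R n) s w :
  p = hmul (vpt n s) (wpt w) -> piV p = vpt n s /\ piW p = wpt w.
Proof.
move=> ->; have E : piV (hmul (vpt n s) (wpt w)) = vpt n s.
  congr pair; apply/rowP => i; rewrite !mxE.
  case: eqP => // i0; rewrite big1 ?addr0 // => j.
  by rewrite i0.
split=> //; rewrite /piW E /hmul /hinv /=; congr pair.
  by rewrite addKr.
rewrite oppr0 !add0r -addrA -mulrDr -big_split /= [X in _ * X]big1.
  by rewrite mulr0 addr0.
by move=> i _; rewrite !mxE /=; ring.
Qed.

Lemma hdecomp_exists (R : realType) (n : nat) (p : heis R n) : (0 < n)%N ->
  exists s w, p = hmul (vpt n s) (wpt w).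
Proof.
case: n p => // n p _.
pose s := p.1 0 ord0.
pose x : 'rV[R]_(n.+1 + n.+1).-1 := \row_j p.1 0 (lift ord0 j).
pose t := p.2 - (hmul (vpt n.+1 s) (wpt (x, 0))).2.
exists s, (x, t); rewrite [LHS]surjective_pairing; congr pair; last first.
  by rewrite /t /hmul /=; ring.
apply/rowP => i; rewrite !mxE.
case: (unliftP ord0 i) => [j ->|->] /=.
  rewrite add0r (bigD1 j) //= big1 ?addr0 ?mxE //.
  move=> k /andP[/eqP]; rewrite /bump /= add1n => -[] kj.
  by move/negP; case; apply/eqP/val_inj.
by rewrite big1 ?addr0.
Qed.

Lemma dset_inj (R : realType) : injective (dset R).
Proof.
have gt0 Q : 0 < dlen R Q by rewrite exprz_gt0.
have sub Q Q' : dset R Q `<=` dset R Q' ->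
    Q'.2%:~R * dlen R Q' <= Q.2%:~R * dlen R Q
    /\ (Q.2 + 1)%:~R * dlen R Q <= (Q'.2 + 1)%:~R * dlen R Q'.
  rewrite /dset !rmorphD /= => QQ'; have := gt0 Q; have := gt0 Q'.
  set a := _%:~R * _ in QQ' *; set b := (_ + _) * _ in QQ' *.
  set a' := _%:~R * _ in QQ' *; set b' := (_ + _) * _ in QQ' *.
  move=> _ l0; have ab : a < b by rewrite /a /b mulrDl ltrDl mul1r.
  have /= := QQ' a; rewrite !in_itv /= lexx ab => /(_ isT)/andP[a'a ab'].
  split=> //; rewrite leNgt; apply/negP => b'b.
  have /= := QQ' b'; rewrite !in_itv /= (ltW ab') b'b ltxx andbF => /(_ isT).
  by [].
move=> [k m] [k' m'] E.
have [a1 b1] := sub (k, m) (k', m') ltac:(by rewrite E).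
have [a2 b2] := sub (k', m') (k, m) ltac:(by rewrite E).
have Ea : m%:~R * dlen R (k, m) = m'%:~R * dlen R (k', m').
  by apply/eqP; rewrite eq_le a1 a2.
have Eb : (m + 1)%:~R * dlen R (k, m) = (m' + 1)%:~R * dlen R (k', m').
  by apply/eqP; rewrite eq_le b1 b2.
have El : dlen R (k, m) = dlen R (k', m').
  by move: Eb; rewrite !rmorphD /= !mulrDl Ea !mul1r => /addrI.
have Ek : k = k'.
  by apply: (@ieexprIz R 2%:R) => //; rewrite ?ltr0n // pnatr_eq1.
move: Ea; rewrite El => /mulIf -/(_ (lt0r_neq0 (gt0 _)))/eqP.
by rewrite eqr_int => /eqP ->; rewrite Ek.
Qed.

(* Main.v *)
Require Import Defs.
From HB Require Import structures.
From mathcomp Require Import all_boot all_order all_algebra.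
From mathcomp Require Import all_classical all_reals all_analysis.
From mathcomp Require Import ring lra zify finmap.

Set Implicit Arguments.
Unset Strict Implicit.
Unset Printing Implicit Defensive.

Import Order.TTheory GRing.Theory Num.Theory.

Local Open Scope classical_set_scope.
Local Open Scope ring_scope.

(** Write phi = (f, tau), and let g be the coordinate of f that is conjugate to
    the graph variable.  In coordinates (lemma intrinsic_lipschitzE) phi is
    intrinsic Lipschitz if and only if f is Lipschitz and the defect
      tau(s) - tau(s') + (s - s') g(s') - om(f(s'), f(s)) / 2
    is O((s - s')^2), where om is the symplectic form of the remaining
    coordinates: the graph is a horizontal curve, and tau is the signed area
    swept by f.  The distance between the points phi(s) and psi(s) of two such
    graphs consists of the distance of the horizontal parts and of the square
    root of a gap, whose derivative is linear in the difference of the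
    horizontal parts (gap_increment).

    The coronization only sees the 1-Lipschitz map f.  An interval is bad if f is
    not affine up to eps |Q| on 3Q.  The variance of the slopes of f over the 2^N
    parts of a window [x, x + 4h], integrated over x, telescopes in the scale h
    and therefore has a bounded sum over all dyadic scales; every bad interval
    forces a large variance for a set of x of length |Q|, and these sets are
    disjoint for intervals of the same generation (sum_nonflat).  So the bad
    intervals have a Carleson packing.  The trees are obtained by following the
    good intervals down from a top as long as both children are good and have
    slopes within eps of the slope of the top.  The tops are packed because
      |Q| (1 - |m_Q|^2 + |m_Q - m_top|^2),
    with m_Q the slope of f over Q, is additive along a tree and drops by a
    multiple of |Q| when a tree stops because of its slope (subsum_tops_below).

    On a tree with top P, f is replaced over each minimal interval by its chord,
    is kept at the points outside of all minimal intervals, and is extended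
    linearly outside of P.  All tree intervals have slopes close to m_P, so this
    interpolation is a small Lipschitz perturbation of the linear map of slope m_P
    (core_dev, interp_dev_le).  It is eps-close to f at the scale of every tree
    interval, but the areas of f and of its interpolation could drift apart when
    many minimal intervals are crossed.  To prevent this, each chord carries a
    bump in the direction conjugate to the graph variable.  Motion in this
    direction changes the area without changing om, and the bump restores equality
    of the areas at the right endpoint.  Its size is controlled by the flatness of
    f on the minimal interval (area_defect_le).  Consequently the gap vanishes at
    the endpoints of all tree intervals, and by gap_le it is at most of order
    eps |Q|^2 on 2Q. *)

(** * The Euclidean norm *)

Section Euclid.
Variables (R : realType) (k : nat).
Implicit Types (u v w : 'rV[R]_k) (a c : R).

Definition dot u v : R := \sum_(i < k) u 0 i * v 0 i.

Lemma dotC u v : dot u v = dot v u.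
Proof. by apply: eq_bigr => i _; rewrite mulrC. Qed.

Lemma dotDl u v w : dot (u + v) w = dot u w + dot v w.
Proof. by rewrite -big_split; apply: eq_bigr => i _; rewrite mxE mulrDl. Qed.

Lemma dotZl a u w : dot (a *: u) w = a * dot u w.
Proof. by rewrite mulr_sumr; apply: eq_bigr => i _; rewrite mxE mulrA. Qed.

Lemma dotNl u w : dot (- u) w = - dot u w.
Proof. by rewrite -scaleN1r dotZl mulN1r. Qed.

Lemma dotDr u v w : dot w (u + v) = dot w u + dot w v.
Proof. by rewrite dotC dotDl !(dotC w). Qed.

Lemma dotNr u w : dot w (- u) = - dot w u.
Proof. by rewrite dotC dotNl dotC. Qed.

Lemma dotZr a u w : dot w (a *: u) = a * dot w u.
Proof. by rewrite dotC dotZl dotC. Qed.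

Lemma dot_ge0 u : 0 <= dot u u.
Proof. by apply: sumr_ge0 => i _; rewrite -expr2 sqr_ge0. Qed.

Lemma enorm_ge0 u : 0 <= enorm u.
Proof. exact: sqrtr_ge0. Qed.

Lemma enorm_sqr u : enorm u ^+ 2 = dot u u.
Proof.
rewrite sqr_sqrtr; last by apply: sumr_ge0 => i _; rewrite sqr_ge0.
by apply: eq_bigr => i _; rewrite expr2.
Qed.

Lemma enormZ a u : enorm (a *: u) = `|a| * enorm u.
Proof.
apply/eqP; rewrite -(eqrXn2 (n := 2)) ?mulr_ge0 ?enorm_ge0 //.
by rewrite exprMn !enorm_sqr dotZl dotZr mulrA -expr2 real_normK ?num_real.
Qed.

Lemma enormN u : enorm (- u) = enorm u.
Proof. by rewrite -scaleN1r enormZ normrN1 mul1r. Qed.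

Lemma enorm0 : enorm (0 : 'rV[R]_k) = 0.
Proof. by rewrite -(scale0r 0) enormZ normr0 mul0r. Qed.

Lemma coord_le_enorm u i : `|u 0 i| <= enorm u.
Proof.
rewrite -(ler_pXn2r (n := 2)) ?nnegrE ?enorm_ge0 //.
rewrite enorm_sqr real_normK ?num_real // /dot (bigD1 i) //= -expr2 lerDl.
by apply: sumr_ge0 => j _; rewrite -expr2 sqr_ge0.
Qed.

Lemma enorm_eq0 u : enorm u = 0 -> u = 0.
Proof.
move=> u0; apply/rowP => i; rewrite mxE; apply/eqP.
by rewrite -normr_le0 -u0 coord_le_enorm.
Qed.

Lemma dot0l u : dot 0 u = 0.
Proof. by rewrite -(scale0r 0) dotZl mul0r. Qed.

Lemma dot_le u v : dot u v <= enorm u * enorm v.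
Proof.
have [/enorm_eq0 ->|un0] := eqVneq (enorm u) 0; first by rewrite dot0l enorm0 mul0r.
have [/enorm_eq0 ->|vn0] := eqVneq (enorm v) 0.
  by rewrite dotC dot0l enorm0 mulr0.
have := dot_ge0 (enorm v *: u - enorm u *: v).
rewrite !(dotDl, dotDr, dotNl, dotNr, dotZl, dotZr) (dotC v u) -!enorm_sqr.
have uv_gt0 : 0 < enorm u * enorm v.
  by rewrite mulr_gt0 // lt_def ?un0 ?vn0 enorm_ge0.
move: uv_gt0; move: (enorm u) (enorm v) (dot u v) => x y d xy_gt0 H.
by rewrite -(ler_pM2l xy_gt0); nra.
Qed.

Lemma enormD u v : enorm (u + v) <= enorm u + enorm v.
Proof.
rewrite -(ler_pXn2r (n := 2)) ?nnegrE ?addr_ge0 ?enorm_ge0 //.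
rewrite enorm_sqr !(dotDl, dotDr) (dotC v u) -!enorm_sqr.
by have := dot_le u v; nra.
Qed.

Lemma enormB u v : enorm (u - v) <= enorm u + enorm v.
Proof. by rewrite -(enormN v) enormD. Qed.

Lemma enorm_sum (I : Type) (r : seq I) (P : pred I) (F : I -> 'rV[R]_k) :
  enorm (\sum_(i <- r | P i) F i) <= \sum_(i <- r | P i) enorm (F i).
Proof.
elim/big_rec2: _ => [|i x y _ le_yx]; first by rewrite enorm0.
by apply: le_trans (enormD _ _) _; rewrite lerD2l.
Qed.

Lemma dot_suml (I : Type) (r : seq I) (F : I -> 'rV[R]_k) w :
  dot (\sum_(i <- r) F i) w = \sum_(i <- r) dot (F i) w.
Proof. by elim/big_rec2: _ => [|i x y _ <-]; rewrite ?dot0l ?dotDl. Qed.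

End Euclid.

(** * Flatness from small variance of the slopes *)

Section Flatness.
Variables (R : realType) (k : nat) (f : R -> 'rV[R]_k).
Hypothesis f_lip : elipschitz 1 f.

Definition slope (x h : R) : 'rV[R]_k := h^-1 *: (f (x + h) - f x).

Definition flat (a b r : R) : Prop :=
  exists v : 'rV[R]_k, forall s s', a <= s <= b -> a <= s' <= b ->
    enorm (f s - f s' - (s - s') *: v) <= r.

Lemma flat_sub a b a' b' r r' :
  flat a b r -> a <= a' -> b' <= b -> r <= r' -> flat a' b' r'.
Proof.
move=> [v fv] aa' bb' rr'; exists v => s s' /andP[a1 a2] /andP[b1 b2].
apply: le_trans rr'; apply: fv.
  by rewrite (le_trans aa' a1) (le_trans a2).
by rewrite (le_trans aa' b1) (le_trans b2).
Qed.

Lemma lip1 s s' : enorm (f s - f s') <= `|s - s'|.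
Proof. by rewrite -[X in _ <= X]mul1r f_lip. Qed.

Lemma slopeE (x h : R) : 0 < h -> h *: slope x h = f (x + h) - f x.
Proof. by move=> h0; rewrite scalerA divff ?scale1r // gt_eqF. Qed.

Lemma slope_le1 (x h : R) : 0 < h -> enorm (slope x h) <= 1.
Proof.
move=> h0; rewrite enormZ gtr0_norm ?invr_gt0 // ler_pdivrMl // mulr1.
by apply: le_trans (lip1 _ _) _; rewrite addrC addKr gtr0_norm.
Qed.

Lemma sum_slope (x h : R) (n : nat) : 0 < h ->
  \sum_(l < n) h *: slope (x + l%:R * h) h = f (x + n%:R * h) - f x.
Proof.
move=> h0; elim: n => [|n IHn]; first by rewrite big_ord0 mul0r addr0 subrr.
rewrite big_ord_recr /= IHn slopeE //.
have -> : x + n.+1%:R * h = x + n%:R * h + h by rewrite -natr1; ring.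
by rewrite addrC subrKA.
Qed.

Lemma slope_avg (x h : R) (n : nat) : 0 < h -> (0 < n)%N ->
  n%:R *: slope x (n%:R * h) = \sum_(l < n) slope (x + l%:R * h) h.
Proof.
move=> h0 n0; have nh0 : 0 < n%:R * h by rewrite mulr_gt0 ?ltr0n.
apply: (scalerI (a := h)); first by rewrite gt_eqF.
rewrite scalerA [h * _]mulrC slopeE // -sum_slope // scaler_sumr.
by [].
Qed.

Lemma sum_sqr_deviation (n : nat) (y : nat -> 'rV[R]_k) (mu : 'rV[R]_k) :
  n%:R *: mu = \sum_(l < n) y l ->
  \sum_(l < n) enorm (y l - mu) ^+ 2 =
    \sum_(l < n) enorm (y l) ^+ 2 - n%:R * enorm mu ^+ 2.
Proof.
move=> Emu.
transitivity (\sum_(l < n) (enorm (y l) ^+ 2 - 2 * dot (y l) mu + enorm mu ^+ 2)).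
  apply: eq_bigr => l _; rewrite !enorm_sqr !(dotDl, dotDr, dotNl, dotNr).
  by rewrite (dotC mu); ring.
rewrite !big_split /= sumr_const card_ord sumrN -mulr_sumr -dot_suml -Emu dotZl.
by rewrite enorm_sqr -[_ *+ n]mulr_natl; ring.
Qed.

(** The sum of the deviations of the slopes from their mean controls f minus its
    chord at the partition points; in between, the Lipschitz bounds of f and of
    the chord cost one piece length each. *)
Lemma flat_of_variance (x h : R) (n : nat) (c : R) : 0 < h -> (0 < n)%N -> 0 < c ->
  \sum_(l < n) enorm (slope (x + l%:R * h) h - slope x (n%:R * h)) ^+ 2
    <= n%:R * c ^+ 2 ->
  flat x (x + n%:R * h) (2 * (n%:R * h * c + 2 * h)).
Proof.
move=> h0 n0 c0; set v := slope x (n%:R * h) => Hvar.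
pose d (l : nat) := slope (x + l%:R * h) h - v.
have nh0 : 0 < n%:R * h by rewrite mulr_gt0 ?ltr0n.
have v1 : enorm v <= 1 by exact: slope_le1.
have Hd : \sum_(l < n) enorm (d l) <= n%:R * c.
  rewrite -(ler_pM2r c0) -mulrA -expr2 mulr_suml.
  have -> : n%:R * c ^+ 2 = (n%:R * c ^+ 2 + n%:R * c ^+ 2) / 2 by field.
  apply: le_trans (_ : (\sum_(l < n) enorm (d l) ^+ 2 + n%:R * c ^+ 2) / 2 <= _).
    rewrite mulr_natl -[X in _ + _ *+ X]card_ord -sumr_const -big_split mulr_suml.
    apply: ler_sum => l _; have := sqr_ge0 (enorm (d l) - c); rewrite /=; nra.
  by rewrite ler_pM2r ?invr_gt0 // lerD2r.
have dev s : x <= s <= x + n%:R * h ->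
    enorm (f s - f x - (s - x) *: v) <= n%:R * h * c + 2 * h.
  move=> /andP[xs sx].
  have q0 : 0 <= (s - x) / h by rewrite divr_ge0 ?subr_ge0 // ltW.
  pose l := Num.truncn ((s - x) / h).
  have /andP[l1 l2] : l%:R <= (s - x) / h < l.+1%:R by exact: truncn_itv.
  have ln : (l <= n)%N.
    rewrite -(ler_nat R); apply: le_trans l1 _.
    by rewrite ler_pdivrMr // lerBlDl.
  move: l1 l2; rewrite ler_pdivlMr // ltr_pdivrMr // => l1 l2.
  pose t := x + l%:R * h.
  have st : `|s - t| <= h.
    rewrite /t ger0_norm; last by lra.
    by move: l2; rewrite -natr1 mulrDl; lra.
  have -> : f s - f x - (s - x) *: v =
      (f t - f x - (l%:R * h) *: v) + ((f s - f t) - (s - t) *: v).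
    rewrite {3}/t addrC.
    have -> : s - x = (s - (x + l%:R * h)) + l%:R * h by ring.
    rewrite scalerDl; move: (f s) (f t) (f x) (_ *: v) (_ *: v) => a b e a' b'.
    by apply/rowP => i; rewrite !mxE; ring.
  have -> : n%:R * h * c + 2 * h = n%:R * h * c + (h + h) by ring.
  apply: le_trans (enormD _ _) (lerD _ _); last first.
    apply: le_trans (enormB _ _) _; apply: lerD.
      exact: le_trans (lip1 _ _) st.
    rewrite enormZ -[X in _ <= X]mulr1.
    by apply: ler_pM; rewrite ?enorm_ge0.
  have -> : f t - f x - (l%:R * h) *: v = h *: \sum_(i < l) d i.
    rewrite /t -sum_slope // [\sum_(i < l) d i]big_split /= sumrN sumr_const card_ord.
    by rewrite scalerDr scalerN scaler_sumr mulrC -[in LHS]scalerA scaler_nat.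
  rewrite enormZ gtr0_norm // mulrAC mulrC ler_pM2r //.
  apply: le_trans (enorm_sum _ _ _) (le_trans _ Hd).
  rewrite -!(big_mkord xpredT (fun i => enorm (d i))).
  rewrite [X in _ <= X](big_cat_nat (n := l)) //= lerDl.
  by apply: sumr_ge0 => i _; exact: enorm_ge0.
exists v => s s' hs hs'.
have -> : f s - f s' - (s - s') *: v =
    (f s - f x - (s - x) *: v) - (f s' - f x - (s' - x) *: v).
  have -> : s - s' = (s - x) - (s' - x) by ring.
  rewrite [(_ - _ - _) *: v]scalerBl.
  move: (f s) (f s') (f x) (_ *: v) (_ *: v) => a b e a' b'.
  by apply/rowP => i; rewrite !mxE; ring.
apply: le_trans (enormB _ _) _; rewrite mulr_natl mulr2n.
by apply: lerD; apply: dev.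
Qed.

End Flatness.

(** * Packing of the non-flat intervals *)

Section Packing.
Variable R : realType.

Lemma sum_shift (w : nat -> R) (K t : nat) :
  (forall i, 0 <= w i <= 1) ->
  \sum_(i < K) w (i + t)%N <= \sum_(i < K) w i + t%:R.
Proof.
move=> w01; elim: t => [|t IHt].
  by rewrite addr0; apply: ler_sum => i _; rewrite addn0.
rewrite -natr1 addrA; apply: le_trans (_ : \sum_(i < K) w (i + t)%N + 1 <= _); last first.
  by rewrite lerD2r.
rewrite -lerBlDl -(big_mkord xpredT (fun i => w (i + t.+1)%N)).
rewrite -(big_mkord xpredT (fun i => w (i + t)%N)).
under eq_bigr do rewrite addnS.
rewrite -sumrB; under eq_bigr do rewrite -addSn.
rewrite (telescope_sumr (fun i => w (i + t)%N)) //.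
by have /andP[_ H1] := w01 (K + t)%N; have /andP[H2 _] := w01 (0 + t)%N; lra.
Qed.

Lemma sum_telescope_le (W : nat -> R) (N J : nat) (K : R) :
  (forall j, 0 <= W j <= K) ->
  \sum_(j < J) (W j - W (j + N)%N) <= N%:R * K.
Proof.
move=> W01.
have E : \sum_(j < J) (W j - W (j + N)%N) + \sum_(l < N) W (l + J)%N
         = \sum_(l < N) W l.
  elim: J => [|J IHJ].
    by rewrite big_ord0 add0r; apply: eq_bigr => l _; rewrite addn0.
  rewrite -IHJ big_ord_recr /= -!addrA; congr +%R.
  have E : \sum_(l < N) W (l + J)%N + W (N + J)%N = W J + \sum_(l < N) W (l + J.+1)%N.
    transitivity (\sum_(l < N.+1) W (l + J)%N); first by rewrite big_ord_recr.
    rewrite big_ord_recl /= add0n; congr +%R; apply: eq_bigr => l _.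
    by rewrite /bump /= add1n addSnnS.
  by move: E; rewrite [(N + J)%N]addnC => E; lra.
have -> : \sum_(j < J) (W j - W (j + N)%N) =
    \sum_(l < N) W l - \sum_(l < N) W (l + J)%N by rewrite -E addrK.
apply: le_trans (_ : \sum_(l < N) W l <= _).
  by rewrite gerBl sumr_ge0 // => l _; have /andP[] := W01 (l + J)%N.
apply: le_trans (_ : \sum_(l < N) K <= _).
  by apply: ler_sum => l _; have /andP[] := W01 l.
by rewrite sumr_const card_ord mulr_natl.
Qed.

Lemma sum_blocks (F : nat -> R) (L H : nat) :
  \sum_(m < L) \sum_(r < H) F (m * H + r)%N = \sum_(i < L * H) F i.
Proof.
rewrite -(big_mkord xpredT F) big_nat_mul big_mkord; apply: eq_bigr => m _.
rewrite -(big_mkord xpredT (fun r => F (m * H + r)%N)).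
rewrite -{2}(add0n (m * H)%N) big_addn mulSn addnK.
by apply: eq_bigr => r _; rewrite addnC.
Qed.

Lemma sum_window_le (F : nat -> R) (b K M : nat) :
  (forall i, 0 <= F i) -> (b + K <= M)%N ->
  \sum_(i < K) F (b + i)%N <= \sum_(i < M) F i.
Proof.
move=> F0 bKM; rewrite -(big_mkord xpredT F).
rewrite (big_cat_nat (n := b)) //=; last by lia.
rewrite [X in _ + X](big_cat_nat (n := (b + K)%N)) //=; last by lia.
rewrite -{3}(add0n b) big_addn addKn -(big_mkord xpredT (fun i => F (b + i)%N)).
rewrite addrCA (eq_bigr (fun i => F (i + b)%N)); last by move=> i _; rewrite addnC.
by rewrite lerDl addr_ge0 // sumr_ge0.
Qed.

Lemma sum_pow2 (J : nat) : \sum_(j < J) (2 ^ j)%:R <= (2 ^ J)%:R :> R.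
Proof.
elim: J => [|J IHJ]; first by rewrite big_ord0.
by rewrite big_ord_recr /= expnS mul2n -addnn natrD lerD2r.
Qed.

Variables (k : nat) (f : R -> 'rV[R]_k).
Hypothesis f_lip : elipschitz 1 f.

Section Grid.
Variables (x0 delta : R).
Hypothesis delta_gt0 : 0 < delta.

Definition grid_slope (i j : nat) : 'rV[R]_k :=
  slope f (x0 + i%:R * delta) ((2 ^ j)%:R * delta).

Definition grid_var (N i j : nat) : R :=
  ((2 ^ N)%:R)^-1 * \sum_(l < 2 ^ N)
     enorm (grid_slope (i + l * 2 ^ j) j - grid_slope i (j + N)) ^+ 2.

Lemma pow2_gt0 (m : nat) : 0 < (2 ^ m)%:R :> R.
Proof. by rewrite ltr0n expn_gt0. Qed.

Lemma grid_slope_shift (i l j : nat) :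
  grid_slope (i + l * 2 ^ j) j =
    slope f (x0 + i%:R * delta + l%:R * ((2 ^ j)%:R * delta)) ((2 ^ j)%:R * delta).
Proof. by congr slope; rewrite natrD natrM; ring. Qed.

Lemma grid_slope_coarse (N i j : nat) :
  grid_slope i (j + N) =
    slope f (x0 + i%:R * delta) ((2 ^ N)%:R * ((2 ^ j)%:R * delta)).
Proof. by congr slope; rewrite expnD natrM; ring. Qed.

Lemma grid_varE (N i j : nat) :
  grid_var N i j =
    ((2 ^ N)%:R)^-1 * \sum_(l < 2 ^ N) enorm (grid_slope (i + l * 2 ^ j) j) ^+ 2
    - enorm (grid_slope i (j + N)) ^+ 2.
Proof.
rewrite /grid_var (sum_sqr_deviation (y := fun l => grid_slope (i + l * 2 ^ j) j)).
  by rewrite mulrBr mulrA mulVf ?mul1r // gt_eqF ?pow2_gt0.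
rewrite grid_slope_coarse slope_avg ?mulr_gt0 ?pow2_gt0 ?expn_gt0 //.
by apply: eq_bigr => l _; rewrite grid_slope_shift.
Qed.

Lemma grid_var_ge0 N i j : 0 <= grid_var N i j.
Proof.
by rewrite mulr_ge0 ?invr_ge0 ?ler0n // sumr_ge0 // => l _; rewrite sqr_ge0.
Qed.

Lemma grid_slope01 i j : 0 <= enorm (grid_slope i j) ^+ 2 <= 1.
Proof.
have := slope_le1 f_lip (x0 + i%:R * delta) (mulr_gt0 (pow2_gt0 j) delta_gt0).
have := enorm_ge0 (grid_slope i j); rewrite -/(grid_slope i j) => h0 h1.
by rewrite sqr_ge0 /= expr_le1.
Qed.

(** Averaging the parallelogram identity over all translates makes the mean
    square slope telescope between scales; the windows at two scales differ by
    a shift, which costs at most the coarse scale. *)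
Lemma sum_grid_var (N K J : nat) :
  \sum_(j < J) \sum_(i < K) grid_var N i j <= N%:R * K%:R + (2 ^ (J + N))%:R.
Proof.
pose W j := \sum_(i < K) enorm (grid_slope i j) ^+ 2.
have W0K j : 0 <= W j <= K%:R.
  rewrite sumr_ge0 /= => [|i _]; last by rewrite sqr_ge0.
  rewrite -[X in _ <= X%:R]card_ord -sumr_const; apply: ler_sum => i _.
  by have /andP[] := grid_slope01 i j.
have level j : \sum_(i < K) grid_var N i j
    <= W j - W (j + N)%N + (2 ^ N)%:R * (2 ^ j)%:R.
  under eq_bigr do rewrite grid_varE.
  rewrite big_split /= sumrN addrAC lerD2r -mulr_sumr exchange_big /=.
  rewrite ler_pdivrMl ?pow2_gt0 //.
  apply: le_trans (_ : \sum_(l < 2 ^ N) (W j + (2 ^ N)%:R * (2 ^ j)%:R) <= _).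
    apply: ler_sum => l _; apply: le_trans (sum_shift _ _ (grid_slope01^~ j)) _.
    by rewrite lerD2l natrM ler_wpM2r ?ler0n // ler_nat ltnW.
  by rewrite sumr_const card_ord -[X in X <= _]mulr_natl.
apply: le_trans (ler_sum _ (fun (j : 'I_J) _ => level j)) _.
rewrite big_split /=; apply: lerD; first exact: sum_telescope_le.
rewrite -mulr_sumr expnD natrM mulrC.
by apply: ler_wpM2r; [rewrite ler0n | exact: sum_pow2].
Qed.

End Grid.

(** Flatness is demanded on the triple of [a, a + h[, as the approximation has to
    be good on 2Q. *)
Definition wide_flat (eps a h : R) : Prop := flat f (a - h) (a + 2 * h) (eps * h).


Section WideFlat.
Variables (eps : R) (N : nat).
Hypotheses (eps_gt0 : 0 < eps) (N_large : 32 <= eps * (2 ^ N)%:R).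

(** The variance contributes eps / 2 to the error, and the length h / 2 ^ N of the
    2 ^ (N + 2) pieces of [x, x + 4 h] at most eps / 8. *)
Lemma wide_flat_of_grid_var (x0 delta : R) (i j : nat) (a h : R) :
  0 < delta -> h = (2 ^ (j + N))%:R * delta ->
  x0 + i%:R * delta <= a - h ->
  a + 2 * h <= x0 + i%:R * delta + 4 * h ->
  grid_var x0 delta N.+2 i j <= (eps / 16) ^+ 2 ->
  wide_flat eps a h.
Proof.
move=> d0 hE xa ax Hvar.
have h0 : 0 < h by rewrite hE mulr_gt0 ?pow2_gt0.
pose p := (2 ^ j)%:R * delta.
have p0 : 0 < p by rewrite mulr_gt0 ?pow2_gt0.
have hp : h = (2 ^ N)%:R * p by rewrite hE expnD natrM /p; ring.
have h4 : (2 ^ N.+2)%:R * p = 4 * h by rewrite hp !expnS !natrM; ring.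
have := @flat_of_variance _ _ _ f_lip (x0 + i%:R * delta) p (2 ^ N.+2) (eps / 16) p0.
rewrite expn_gt0 => /(_ isT); rewrite divr_gt0 // => /(_ isT).
have -> : \sum_(l < 2 ^ N.+2) enorm (slope f (x0 + i%:R * delta + l%:R * p) p -
     slope f (x0 + i%:R * delta) ((2 ^ N.+2)%:R * p)) ^+ 2 =
    (2 ^ N.+2)%:R * grid_var x0 delta N.+2 i j.
  rewrite /grid_var [RHS]mulrA mulfV ?mul1r ?gt_eqF ?pow2_gt0 //.
  by apply: eq_bigr => l _; rewrite grid_slope_shift grid_slope_coarse.
rewrite ler_pM2l ?pow2_gt0 // Hvar => /(_ isT) Hf.
apply: flat_sub Hf xa _ _; first by rewrite h4.
rewrite h4; have : 32 * p <= eps * h by rewrite hp mulrA ler_pM2r.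
by rewrite mulrA; nra.
Qed.

Definition nonflat_len (a h : R) : R := (`[< ~ wide_flat eps a h >])%:R * h.

(** A non-flat interval [a, a + h[ makes the variance of [x, x + 4 h[ large for
    all x in [a - 2 h, a - h[; as these ranges of x are disjoint for different
    intervals of one generation, the lengths add up. *)
Lemma sum_nonflat (a h : R) (J : nat) : 0 < h ->
  \sum_(g < J) \sum_(m < 2 ^ g) nonflat_len (a + m%:R * (h / (2 ^ g)%:R)) (h / (2 ^ g)%:R)
    <= (eps / 16) ^- 2 * (3 * N.+2%:R + 8) * h.
Proof.
move=> h0; case: J => [|J].
  by rewrite big_ord0 !mulr_ge0 ?invr_ge0 ?exprn_ge0 ?divr_ge0 ?addr_ge0 ?mulr_ge0 ?ler0n // ltW.
pose K0 := (2 ^ (J + N))%N; pose delta := h / K0%:R; pose x0 := a - 2 * h.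
have K0gt0 : 0 < K0%:R :> R by exact: pow2_gt0.
have d0 : 0 < delta by rewrite divr_gt0.
have hE : h = K0%:R * delta by rewrite mulrCA divff ?mulr1 // gt_eqF.
pose V := fun i j => grid_var x0 delta N.+2 i j.
set c := eps / 16; have c0 : 0 < c by rewrite divr_gt0.
have cd0 : 0 <= c ^- 2 * delta.
  by rewrite mulr_ge0 ?invr_ge0 ?exprn_ge0 // ltW.
have total : \sum_(j < J.+1) \sum_(i < 3 * K0) V i j <= (3 * N.+2%:R + 8) * K0%:R.
  apply: le_trans (sum_grid_var _ _ _ _ _) _ => //.
  rewrite natrM (_ : J.+1 + N.+2 = (J + N).+3)%N; last by lia.
  by rewrite !expnS !natrM -/K0; lra.
have level (g : 'I_J.+1) :
    \sum_(m < 2 ^ g) nonflat_len (a + m%:R * (h / (2 ^ g)%:R)) (h / (2 ^ g)%:R)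
    <= c ^- 2 * delta * \sum_(i < 3 * K0) V i (J - g)%N.
  have gJ : (g <= J)%N by rewrite -ltnS.
  set j := (J - g)%N; pose H := (2 ^ (j + N))%N; set hg := h / _.
  have K0E : K0 = (2 ^ g * H)%N by rewrite /K0 /H -expnD; congr expn; lia.
  have hgE : hg = H%:R * delta.
    rewrite /hg hE K0E natrM; field.
    by rewrite gt_eqF // pow2_gt0.
  have H0 : (0 < H)%N by rewrite expn_gt0.
  have HK : (H <= K0)%N by rewrite K0E leq_pmull // expn_gt0.
  have one m : nonflat_len (a + m%:R * hg) hg <=
      c ^- 2 * delta * \sum_(r < H) V (2 * K0 - 2 * H + (m * H + r))%N j.
    rewrite /nonflat_len; case: asboolP => nf; last first.
      by rewrite mul0r mulr_ge0 // sumr_ge0 // => r _; exact: grid_var_ge0.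
    rewrite mul1r {1}hgE.
    have -> : c ^- 2 * delta * \sum_(r < H) V (2 * K0 - 2 * H + (m * H + r))%N j =
       c ^- 2 * (\sum_(r < H) V (2 * K0 - 2 * H + (m * H + r))%N j) * delta by ring.
    rewrite ler_pM2r // ler_pdivlMl ?exprn_gt0 // mulrC -[X in X%:R * _]card_ord mulr_natl.
    rewrite -sumr_const; apply: ler_sum => r _.
    rewrite leNgt; apply/negP => /ltW HV; apply: nf.
    have xiE : x0 + (2 * K0 - 2 * H + (m * H + r))%:R * delta =
        a + m%:R * hg - 2 * hg + r%:R * delta.
      rewrite natrD natrB ?leq_mul2l ?HK ?orbT // natrD !natrM /x0 hgE hE; ring.
    apply: (wide_flat_of_grid_var d0 hgE _ _ HV); rewrite xiE.
      have : r%:R * delta <= hg by rewrite hgE ler_pM2r // ler_nat ltnW.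
      lra.
    have : 0 <= r%:R * delta by rewrite mulr_ge0 ?ler0n ?ltW.
    lra.
  apply: le_trans (ler_sum _ (fun (m : 'I_(2 ^ g)) _ => one m)) _.
  rewrite -mulr_sumr ler_wpM2l //.
  rewrite (sum_blocks (fun i => V (2 * K0 - 2 * H + i)%N j)) -K0E.
  apply: (sum_window_le (F := V^~ (J - g)%N)) => [i|]; [exact: grid_var_ge0 | lia].
have -> : c ^- 2 * (3 * N.+2%:R + 8) * h =
    c ^- 2 * delta * ((3 * N.+2%:R + 8) * K0%:R) by rewrite [in LHS]hE; ring.
apply: le_trans (ler_sum _ (fun (g : 'I_J.+1) _ => level g)) _.
rewrite -mulr_sumr ler_wpM2l //.
apply: le_trans _ total; rewrite le_eqVlt; apply/orP; left; apply/eqP.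
by rewrite [RHS](reindex_inj rev_ord_inj); apply: eq_bigr => g _; rewrite /= subSS.
Qed.

End WideFlat.

End Packing.

(** * Dyadic intervals and sums over descendants *)

Section Dyadics.
Variable R : realType.
Implicit Types Q P : dyadic.

Definition dlo Q : R := Q.2%:~R * dlen R Q.
Definition dhi Q : R := dlo Q + dlen R Q.
Definition par Q : dyadic := (Q.1 + 1, (Q.2 %/ 2)%Z).

Lemma dlen_gt0 Q : 0 < dlen R Q.
Proof. by rewrite exprz_gt0. Qed.

Lemma dsetE Q s : dset R Q s <-> dlo Q <= s < dhi Q.
Proof. by rewrite /dset /= in_itv /= /dhi /dlo rmorphD mulrDl mul1r. Qed.

Lemma dlen_pred (k : int) : (2%:R ^ (k - 1) : R) = 2%:R ^ k / 2.
Proof. by rewrite expfzDr ?pnatr_eq0 // -exprN1. Qed.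

Lemma dlen_child_l Q : dlen R (child_l Q) = dlen R Q / 2.
Proof. exact: dlen_pred. Qed.

Lemma dlen_child_r Q : dlen R (child_r Q) = dlen R Q / 2.
Proof. exact: dlen_pred. Qed.

Lemma dlo_child_l Q : dlo (child_l Q) = dlo Q.
Proof. by rewrite /dlo dlen_child_l rmorphM /=; field. Qed.

Lemma dlo_child_r Q : dlo (child_r Q) = dlo Q + dlen R Q / 2.
Proof. by rewrite /dlo dlen_child_r rmorphD rmorphM /=; field. Qed.

Lemma dhi_child_l Q : dhi (child_l Q) = dlo Q + dlen R Q / 2.
Proof. by rewrite /dhi dlo_child_l dlen_child_l. Qed.

Lemma dhi_child_r Q : dhi (child_r Q) = dhi Q.
Proof. by rewrite /dhi dlo_child_r dlen_child_r; field. Qed.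

Lemma par_child_l Q : par (child_l Q) = Q.
Proof. by case: Q => k m; rewrite /par /child_l /= subrK mulzK. Qed.

Lemma par_child_r Q : par (child_r Q) = Q.
Proof. case: Q => k m; rewrite /par /child_r /= subrK; congr pair; lia. Qed.

Lemma child_of_par Q : Q = child_l (par Q) \/ Q = child_r (par Q).
Proof.
case: Q => k m; rewrite /par /child_l /child_r /= addrK.
have : (m %% 2)%Z = 0 \/ (m %% 2)%Z = 1 by lia.
by case=> h; [left | right]; congr pair; lia.
Qed.

Lemma dlo_par Q : dlo (par Q) <= dlo Q.
Proof.
case: (child_of_par Q) => E; rewrite {2}E ?dlo_child_l ?dlo_child_r //.
by rewrite lerDl divr_ge0 // ltW // dlen_gt0.
Qed.

Lemma dhi_par Q : dhi Q <= dhi (par Q).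
Proof.
case: (child_of_par Q) => E; rewrite {1}E ?dhi_child_l ?dhi_child_r //.
by rewrite /dhi; have := dlen_gt0 (par Q); lra.
Qed.

Lemma dlo_anc j Q : dlo (iter j par Q) <= dlo Q.
Proof. by elim: j => //= j IHj; apply: le_trans (dlo_par _) IHj. Qed.

Lemma dhi_anc j Q : dhi Q <= dhi (iter j par Q).
Proof. by elim: j => //= j IHj; apply: le_trans IHj (dhi_par _). Qed.

Lemma anc_level j Q : (iter j par Q).1 = Q.1 + j%:Z.
Proof. by elim: j => [|j IHj] /=; rewrite ?addr0 // IHj; lia. Qed.

Lemma dset_anc j Q : dset R Q `<=` dset R (iter j par Q).
Proof.
move=> s /dsetE /andP[h1 h2]; apply/dsetE.
by rewrite (le_trans (dlo_anc _ _) h1) (lt_le_trans h2 (dhi_anc _ _)).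
Qed.

Lemma same_level Q Q' s : Q.1 = Q'.1 -> dset R Q s -> dset R Q' s -> Q = Q'.
Proof.
case: Q Q' => k m [k' m'] /= <- /dsetE /andP[a b] /dsetE /andP[a' b'].
congr pair; move: a b a' b'; rewrite /dhi /dlo /dlen /=.
have l0 : 0 < 2%:R ^ k :> R by rewrite exprz_gt0.
set l := _ ^ _ in l0 * => a b a' b'.
have h1 : (m%:~R : R) < (m' + 1)%:~R.
  by rewrite -(ltr_pM2r l0) rmorphD mulrDl mul1r; lra.
have h2 : (m'%:~R : R) < (m + 1)%:~R.
  by rewrite -(ltr_pM2r l0) rmorphD mulrDl mul1r; lra.
by move: h1 h2; rewrite !ltr_int; lia.
Qed.

Lemma dyadic_nested Q Q' s : Q.1 <= Q'.1 -> dset R Q s -> dset R Q' s ->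
  exists j, Q' = iter j par Q.
Proof.
move=> le_lev Qs Q's; exists `|Q'.1 - Q.1|%N.
apply: (@same_level _ _ s) => //; last exact: dset_anc.
by rewrite anc_level; lia.
Qed.

Lemma dset_lo Q : dset R Q (dlo Q).
Proof. by apply/dsetE; rewrite lexx /dhi ltrDl dlen_gt0. Qed.

Lemma level_le Q Q' : dlen R Q <= dlen R Q' -> Q.1 <= Q'.1.
Proof. by rewrite /dlen ler_eXz2l // ltr1n. Qed.

Lemma dset_sub_bounds Q Q' :
  dset R Q `<=` dset R Q' -> dlo Q' <= dlo Q /\ dhi Q <= dhi Q'.
Proof.
move=> QQ'; have /dsetE/andP[h1 h2] := QQ' _ (dset_lo Q).
split=> //; rewrite leNgt; apply/negP => h3.
have /QQ'/dsetE : dset R Q (dhi Q') by apply/dsetE; rewrite h3 ltW.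
by rewrite ltxx andbF.
Qed.

Lemma dset_sub_anc Q Q' : dset R Q `<=` dset R Q' <-> exists j, Q' = iter j par Q.
Proof.
split=> [QQ'|[j ->]]; last exact: dset_anc.
apply: (@dyadic_nested _ _ (dlo Q)); [|exact: dset_lo|exact/QQ'/dset_lo].
have [h1 h2] := dset_sub_bounds QQ'; apply: level_le.
by move: h1 h2; rewrite /dhi; lra.
Qed.

(** The recursion follows the binary tree, so that stopping-time arguments are
    inductions on J. *)
Fixpoint subsum (B : set dyadic) (J : nat) Q : R :=
  if J is J'.+1 then
    (`[< B Q >])%:R * dlen R Q + subsum B J' (child_l Q) + subsum B J' (child_r Q)
  else 0.

Lemma ind_len_ge0 (B : set dyadic) Q : 0 <= (`[< B Q >])%:R * dlen R Q.
Proof. by rewrite mulr_ge0 ?ler0n // ltW // dlen_gt0. Qed.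

Lemma subsum_le B B' J Q : (forall P, B P -> B' P) -> subsum B J Q <= subsum B' J Q.
Proof.
move=> BB'; elim: J Q => //= J IHJ Q; rewrite !lerD //.
rewrite ler_wpM2r ?ler_nat ?(ltW (dlen_gt0 Q)) //.
by case: asboolP => // /BB' /asboolP ->.
Qed.

Lemma subsumU B B' J Q :
  subsum (B `|` B') J Q <= subsum B J Q + subsum B' J Q.
Proof.
elim: J Q => /= [|J IHJ] Q; first by rewrite addr0.
apply: le_trans (_ : (`[< B Q >]%:R * dlen R Q + `[< B' Q >]%:R * dlen R Q) +
  (subsum B J (child_l Q) + subsum B' J (child_l Q)) +
  (subsum B J (child_r Q) + subsum B' J (child_r Q)) <= _); last by lra.
rewrite !lerD // -mulrDl ler_wpM2r ?(ltW (dlen_gt0 Q)) // -natrD ler_nat.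
by do 3 case: asboolP => //; move=> ? ? [].
Qed.

Lemma subsum_levels B J Q :
  subsum B J Q = \sum_(g < J) \sum_(m < 2 ^ g)
    (`[< B (Q.1 - g%:Z, Q.2 * (2 ^ g)%:Z + m%:Z) >])%:R
    * dlen R (Q.1 - g%:Z, Q.2 * (2 ^ g)%:Z + m%:Z).
Proof.
elim: J Q => [|J IHJ] Q; first by rewrite big_ord0.
rewrite big_ord_recl big_ord1 /= -addrA; congr +%R.
  by rewrite subr0 mulr1 addr0; case: Q.
rewrite !IHJ -big_split /=; apply: eq_bigr => g _.
rewrite /bump /= add1n expnS mul2n -addnn big_split_ord /=.
congr +%R; apply: eq_bigr => m _; congr ((`[< B _ >])%:R * dlen R _);
  congr pair; nia.
Qed.

Lemma sum_le_subsum B J Q0 (s : seq dyadic) : uniq s ->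
  (forall Q, Q \in s -> B Q /\ exists2 j, (j < J)%N & iter j par Q = Q0) ->
  \sum_(Q <- s) dlen R Q <= subsum B J Q0.
Proof.
elim: J Q0 s => [|J IHJ] Q0 s us Hs /=.
  case: s us Hs => [|Q s] _ Hs; first by rewrite big_nil.
  by have [_ []] := Hs Q (mem_head _ _).
pose below P := [pred Q | `[< exists2 j, (j < J)%N & iter j par Q = P >]].
have IH P : \sum_(Q <- s | below P Q) dlen R Q <= subsum B J P.
  rewrite -big_filter; apply: IHJ => [|Q]; first exact: filter_uniq.
  by rewrite mem_filter => /andP[/asboolP ? /Hs[]].
rewrite (bigID (pred1 Q0)) /= -addrA; apply: lerD.
  have [Q0s|Q0s] := boolP (Q0 \in s); last first.
    rewrite big_seq_cond big1 ?ind_len_ge0 // => Q /andP[Qs /eqP QE].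
    by rewrite -QE Qs in Q0s.
  rewrite -big_filter filter_pred1_uniq // big_seq1.
  by have [/asboolP -> _] := Hs _ Q0s; rewrite mul1r.
apply: le_trans (lerD (IH (child_l Q0)) (IH (child_r Q0))).
rewrite big_mkcond [X in _ <= X + _]big_mkcond [X in _ <= _ + X]big_mkcond /=.
rewrite -big_split /= [X in X <= _]big_seq [X in _ <= X]big_seq /=.
apply: ler_sum => Q Qs; have [_ [j jJ QE]] := Hs _ Qs.
have l0 := dlen_gt0 Q; case: eqP => [_|QQ0] /=; first by case: ifP; case: ifP; lra.
case: j jJ QE => [|j] jJ //= QE.
have : below (child_l Q0) Q || below (child_r Q0) Q.
  case: (child_of_par (iter j par Q)); rewrite QE => E.
    by apply/orP; left; apply/asboolP; exists j.
  by apply/orP; right; apply/asboolP; exists j.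
by rewrite /below /=; do 2 case: asboolP => _ //=; lra.
Qed.

Lemma esum_le_subsum B Q0 (c : R) : (forall J, subsum B J Q0 <= c) ->
  (\esum_(Q in [set Q | B Q /\ dset R Q `<=` dset R Q0]) (dlen R Q)%:E <= c%:E)%E.
Proof.
move=> Hc; apply: ge_ereal_sup => _ [A [finA AB] <-].
rewrite fsbig_finite //= sumEFin lee_fin.
set s := fset_set A.
have sE Q : Q \in (s : seq _) -> A Q by rewrite in_fset_set // => /set_mem.
have [J HJ] : exists J, forall Q, Q \in (s : seq _) ->
    exists2 j, (j < J)%N & iter j par Q = Q0.
  have : forall Q, Q \in (s : seq _) -> A Q by exact: sE.
  elim: (s : seq _) => [|P r IHr] Hr; first by exists 0%N.
  have [|J HJ] := IHr; first by move=> Q Qr; apply: Hr; rewrite inE Qr orbT.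
  have [_ /dset_sub_anc [j jE]] := AB _ (Hr _ (mem_head _ _)).
  exists (maxn J j.+1) => Q; rewrite inE => /orP[/eqP ->|/HJ[i iJ iE]].
    by exists j; rewrite // leq_max ltnSn orbT.
  by exists i; rewrite // leq_max iJ.
apply: le_trans (Hc J); apply: sum_le_subsum; first exact: fset_uniq.
by move=> Q Qs; split; [have [] := AB _ (sE _ Qs) | exact: HJ].
Qed.

End Dyadics.

(** * The coronization *)

Section Coronization.
Variables (R : realType) (k : nat) (f : R -> 'rV[R]_k).
Hypothesis f_lip : elipschitz 1 f.
Variable eps : R.
Implicit Types Q P : dyadic.

Definition dslope Q : 'rV[R]_k := slope f (dlo R Q) (dlen R Q).

(** The intervals with an endpoint at the origin form the two infinite ascending
    chains of dyadic intervals.  Trees need a maximal element, hence these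
    intervals are declared bad; the length of a chain below Q is at most 2 |Q|. *)
Definition axis : set dyadic := [set Q | Q.2 = 0 \/ Q.2 = -1].

Definition nonflat : set dyadic :=
  [set Q | ~ wide_flat f eps (dlo R Q) (dlen R Q)].

Definition bad : set dyadic := axis `|` nonflat.

(** The condition on Q under which the tree with top P continues to the children
    of Q; it treats both children alike, which makes the trees coherent. *)
Definition keep P Q : Prop :=
  [/\ ~ bad Q, ~ bad (child_l Q), ~ bad (child_r Q),
      enorm (dslope (child_l Q) - dslope P) <= eps
    & enorm (dslope (child_r Q) - dslope P) <= eps].

(** The recursion climbs to the parents; it has to stop before the axis
    intervals, and the number of steps to reach these is at most |Q.2|. *)
Fixpoint tree_root_rec (fuel : nat) Q : dyadic :=
  if fuel is fuel'.+1 then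
    if `[< keep (tree_root_rec fuel' (par Q)) (par Q) >] then tree_root_rec fuel' (par Q)
    else Q
  else Q.

Definition tree_root Q : dyadic := tree_root_rec `|Q.2|%N Q.

Lemma keep_axis P Q : axis Q -> ~ keep P Q.
Proof. by move=> aQ [nb _ _ _ _]; apply: nb; left. Qed.

Lemma axis_par Q : axis Q -> axis (par Q).
Proof. by case=> E; [left | right]; rewrite /= E. Qed.

Lemma par_index Q : ~ axis Q -> (`|(par Q).2| < `|Q.2|)%N.
Proof.
move=> /not_orP[n0 n1]; case: Q n0 n1 => k' m /= n0 n1; lia.
Qed.

Lemma tree_root_rec_fuel n n' Q : (`|Q.2| <= n)%N -> (`|Q.2| <= n')%N ->
  tree_root_rec n Q = tree_root_rec n' Q.
Proof.
have axis_root m P : axis P -> tree_root_rec m P = P.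
  case: m => //= m aP; case: asboolP => // /keep_axis; case.
  exact: axis_par.
elim: n n' Q => [|n IHn] n' Q Qn Qn'.
  by case: Q Qn Qn' => q m /= Qn _; rewrite !axis_root //; left => /=; lia.
case: (pselect (axis Q)) => [aQ|naQ]; first by rewrite !axis_root.
have := par_index naQ; case: n' Qn' => [|n'] Qn' lt_par /=; first by lia.
by rewrite (IHn n' (par Q)) //; lia.
Qed.

Lemma tree_rootE Q :
  tree_root Q = if `[< keep (tree_root (par Q)) (par Q) >] then tree_root (par Q) else Q.
Proof.
case: (pselect (axis Q)) => [aQ|naQ].
  have nk P : ~ keep P (par Q) by exact/keep_axis/axis_par.
  by rewrite /tree_root; case: `|Q.2|%N => [|n] /=; do !case: asboolP => [/nk //|_].
have lt_par := par_index naQ; rewrite {1}/tree_root.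
case E: `|Q.2|%N lt_par => [|n] lt_par /=; first by lia.
by rewrite (@tree_root_rec_fuel n `|(par Q).2|%N (par Q)) //; lia.
Qed.

Lemma tree_root_child_l Q : tree_root (child_l Q) =
  if `[< keep (tree_root Q) Q >] then tree_root Q else child_l Q.
Proof. by rewrite tree_rootE par_child_l. Qed.

Lemma tree_root_child_r Q : tree_root (child_r Q) =
  if `[< keep (tree_root Q) Q >] then tree_root Q else child_r Q.
Proof. by rewrite tree_rootE par_child_r. Qed.

Lemma tree_root_path Q : exists2 j, tree_root Q = iter j par Q &
  forall i, (i < j)%N ->
    keep (tree_root Q) (iter i.+1 par Q) /\ tree_root (iter i.+1 par Q) = tree_root Q.
Proof.
move: {2}`|Q.2|%N (leqnn `|Q.2|%N) => n; elim: n Q => [|n IHn] Q Qn.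
  have aQ : axis Q by case: Q Qn => q m /= Qn; left => /=; lia.
  exists 0%N => //=; rewrite tree_rootE asboolF //.
  exact/keep_axis/axis_par.
rewrite tree_rootE; case: asboolP => [kp|_]; last by exists 0%N.
have naQ : ~ axis Q by move=> /axis_par/keep_axis/(_ kp).
have [|j jE Hj] := IHn (par Q); first by have := par_index naQ; lia.
exists j.+1; first by rewrite iterSr.
by case=> [|i] ij //; rewrite iterSr; apply: Hj.
Qed.

Lemma tree_root_level Q : Q.1 <= (tree_root Q).1.
Proof. by have [j -> _] := tree_root_path Q; rewrite anc_level; lia. Qed.

(** ** The trees *)

Definition tree P : set dyadic := [set Q | ~ bad Q /\ tree_root Q = P].

Definition top_set : set dyadic := [set P | ~ bad P /\ tree_root P = P].

Definition forest : set (set dyadic) := [set tree P | P in top_set].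

Lemma tree_anc P Q : tree P Q -> exists2 j, P = iter j par Q &
  forall i, (i <= j)%N -> tree P (iter i par Q).
Proof.
move=> [nb rQ]; have [j jE Hj] := tree_root_path Q; rewrite rQ in jE Hj.
exists j => // -[|i] ij; first by split.
by have [[nbi _ _ _ _] ri] := Hj i ij; split.
Qed.

Lemma tree_children P Q : tree P Q -> (tree P (child_l Q) <-> tree P (child_r Q)).
Proof.
move=> [nb rQ]; have := tree_root_level Q; rewrite /tree /= tree_root_child_l tree_root_child_r rQ.
move=> lev; case: asboolP => [[_ nl nr _ _]|_]; first by split=> _; split.
by split=> -[_ E]; move: lev; rewrite -E /=; lia.
Qed.

Lemma tree_flat P Q : tree P Q -> wide_flat f eps (dlo R Q) (dlen R Q).
Proof. by move=> [nb _]; apply: contra_notP nb => nf; right. Qed.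

Lemma tree_is_top P : top_set P -> is_top R (tree P) P.
Proof.
move=> [nb rP]; split=> // Q TQ; have [j -> _] := tree_anc TQ.
exact: dset_anc.
Qed.

Lemma tree_topE P : top_set P -> tree_top R (tree P) = P.
Proof.
move=> tP; have [TP maxP] := tree_is_top tP; rewrite /tree_top.
case: xgetP => [Q _ [TQ maxQ]|/(_ P)]; last by case; exact: tree_is_top.
by apply: (@dset_inj R); apply/seteqP; split; [exact: maxP | exact: maxQ].
Qed.

Lemma anc_inj i j Q : iter i par Q = iter j par Q -> i = j.
Proof. by move=> /(congr1 fst); rewrite !anc_level; lia. Qed.

Lemma tree_is_tree P : top_set P -> is_tree R (tree P).
Proof.
move=> tP; rewrite /is_tree tree_topE //; split.
- exact: tree_is_top.
- move=> Q Q' TQ /dset_sub_anc[i ->] /dset_sub_anc[i' E].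
  have [j jE Hj] := tree_anc TQ; apply: Hj.
  move: E; rewrite {1}jE -iterD => /anc_inj ->; exact: leq_addl.
- exact: tree_children.
Qed.

Hypothesis eps_gt0 : 0 < eps.

Lemma tree_slope P Q : tree P Q -> enorm (dslope Q - dslope P) <= eps.
Proof.
move=> [nb]; rewrite tree_rootE; case: asboolP => [[_ _ _ hl hr]|_] <-.
  by case: (child_of_par Q) => ->; rewrite (par_child_l, par_child_r).
by rewrite subrr enorm0 ltW.
Qed.

(** ** Packing of the bad intervals *)

Lemma descendant_len (g m : nat) Q :
  dlen R (Q.1 - g%:Z, Q.2 * (2 ^ g)%:Z + m%:Z) = dlen R Q / (2 ^ g)%:R.
Proof.
by rewrite /dlen /= expfzDr ?pnatr_eq0 // -exprnN natrX.
Qed.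

Lemma descendant_lo (g m : nat) Q :
  dlo R (Q.1 - g%:Z, Q.2 * (2 ^ g)%:Z + m%:Z) =
  dlo R Q + m%:R * (dlen R Q / (2 ^ g)%:R).
Proof.
rewrite {1}/dlo descendant_len /= rmorphD rmorphM /= /dlo.
rewrite -!pmulrn; field.
by rewrite gt_eqF // pow2_gt0.
Qed.

Variable N : nat.
Hypothesis N_large : 32 <= eps * (2 ^ N)%:R.

Definition nonflat_const : R := (eps / 16) ^- 2 * (3 * N.+2%:R + 8).

Lemma subsum_nonflat J Q : subsum R nonflat J Q <= nonflat_const * dlen R Q.
Proof.
rewrite subsum_levels.
apply: le_trans (sum_nonflat f_lip eps_gt0 N_large (dlo R Q) J (dlen_gt0 R Q)).
apply: ler_sum => g _; apply: ler_sum => m _.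
by rewrite /nonflat /= descendant_len descendant_lo.
Qed.

Lemma subsum_axis J Q :
  subsum R axis J Q <= 2 * (`[< axis Q >])%:R * dlen R Q.
Proof.
elim: J Q => [|J IHJ] Q /=.
  by rewrite -mulrA mulr_ge0 // ind_len_ge0.
have := IHJ (child_l Q); have := IHJ (child_r Q).
rewrite dlen_child_l dlen_child_r; have l0 := dlen_gt0 R Q.
have : ((`[< axis (child_l Q) >])%:R + (`[< axis (child_r Q) >])%:R : R)
    <= (`[< axis Q >])%:R.
  rewrite -natrD ler_nat; do 3 case: asboolP => //=; rewrite /axis /=; lia.
by nra.
Qed.

Definition bad_const : R := 2 + nonflat_const.

Lemma subsum_bad J Q : subsum R bad J Q <= bad_const * dlen R Q.
Proof.
apply: le_trans (subsumU _ _ _ _ _) _; rewrite mulrDl; apply: lerD.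
  apply: le_trans (subsum_axis _ _) _; rewrite ler_wpM2r ?(ltW (dlen_gt0 _ _)) //.
  by case: `[< _ >]; rewrite ?mulr1 ?mulr0.
exact: subsum_nonflat.
Qed.

(** ** Packing of the tree tops *)

Lemma dslope_avg Q : 2 *: dslope Q = dslope (child_l Q) + dslope (child_r Q).
Proof.
have l0 : 0 < dlen R Q / 2 by rewrite divr_gt0 ?dlen_gt0.
have := @slope_avg R k f (dlo R Q) (dlen R Q / 2) 2 l0 isT.
rewrite big_ord_recl big_ord1 /= mul0r addr0 mul1r /dslope.
rewrite dlen_child_l dlen_child_r dlo_child_l dlo_child_r => <-.
by congr (_ *: slope _ _ _); field.
Qed.

Lemma dslope_le1 Q : enorm (dslope Q) <= 1.
Proof. by rewrite /dslope; apply: slope_le1 => //; exact: dlen_gt0. Qed.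

(** Nonnegative, as slopes have norm at most 1; the last term records how far the
    slope has moved away from v. *)
Definition energy (v : 'rV[R]_k) Q : R :=
  dlen R Q * (1 - enorm (dslope Q) ^+ 2 + enorm (dslope Q - v) ^+ 2).

Lemma energy_ge0 v Q : 0 <= energy v Q.
Proof.
rewrite mulr_ge0 ?(ltW (dlen_gt0 _ _)) // addr_ge0 ?sqr_ge0 // subr_ge0.
by rewrite expr_le1 // ?enorm_ge0 ?dslope_le1.
Qed.

(** For a fixed v the energy is an affine function of the slope, hence additive. *)
Lemma energy_split v Q : energy v Q = energy v (child_l Q) + energy v (child_r Q).
Proof.
rewrite /energy !enorm_sqr !(dotDl, dotDr, dotNl, dotNr) !(dotC v).
rewrite dlen_child_l dlen_child_r.
have : 2 * dot (dslope Q) v = dot (dslope (child_l Q)) v + dot (dslope (child_r Q)) v.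
  by rewrite -dotZl dslope_avg dotDl.
move: (dlen R Q) (dot (dslope Q) v) (dot (dslope (child_l Q)) v) => l a b E.
have -> : dot (dslope (child_r Q)) v = 2 * a - b by rewrite E; ring.
by field.
Qed.

Lemma energy_restart v Q :
  energy (dslope Q) Q + dlen R Q * enorm (dslope Q - v) ^+ 2 = energy v Q.
Proof. by rewrite /energy subrr enorm0; ring. Qed.

Definition tops : set dyadic := [set Q | tree_root Q = Q].

(** The energy with respect to the slope of the current tree top is a potential:
    it never increases when a tree is restarted, and a restart that is caused by
    a slope deviating by more than eps lowers it by eps ^ 2 / 2 times the length
    of the new tops.  The other restarts are charged to bad intervals. *)
Lemma subsum_tops_below J Q :
  subsum R tops J (child_l Q) + subsum R tops J (child_r Q) <=
    2 * eps ^- 2 * energy (dslope (tree_root Q)) Q + 3 * subsum R bad J.+1 Q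
    - 2 * ((`[< bad Q >])%:R * dlen R Q).
Proof.
have e2 : 0 < eps ^+ 2 by rewrite exprn_gt0.
have ei : 0 < eps ^- 2 by rewrite invr_gt0.
elim: J Q => [|J IHJ] Q.
  rewrite /= !addr0; have := ind_len_ge0 R bad Q.
  have : 0 <= 2 * eps ^- 2 * energy (dslope (tree_root Q)) Q.
    by rewrite mulr_ge0 ?energy_ge0 // mulr_ge0 // ltW.
  by move: (_ * energy _ _) (_ * dlen R Q) => x y; lra.
have tops_rec P : subsum R tops J.+1 P = (`[< tops P >])%:R * dlen R P +
   (subsum R tops J (child_l P) + subsum R tops J (child_r P)) by rewrite /= addrA.
have -> : subsum R bad J.+2 Q = (`[< bad Q >])%:R * dlen R Q
   + subsum R bad J.+1 (child_l Q) + subsum R bad J.+1 (child_r Q) by [].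
rewrite !tops_rec.
have neq_l : tree_root Q <> child_l Q.
  by move=> E; have := tree_root_level Q; rewrite E /=; lia.
have neq_r : tree_root Q <> child_r Q.
  by move=> E; have := tree_root_level Q; rewrite E /=; lia.
set v := dslope (tree_root Q); have l0 := dlen_gt0 R Q.
have bl := ind_len_ge0 R bad (child_l Q); have br := ind_len_ge0 R bad (child_r Q).
move: (IHJ (child_l Q)) (IHJ (child_r Q)) bl br (energy_split v Q).
move: (subsum R bad J.+1 _) (subsum R bad J.+1 _) => Bl Br.
move: (subsum R tops J (child_l (child_l Q)) + _) => Al.
move: (subsum R tops J (child_l (child_r Q)) + _) => Ar.
have -> : (`[< tops (child_l Q) >])%:R = (`[< ~ keep (tree_root Q) Q >])%:R :> R.
  congr (nat_of_bool _)%:R; apply/asbool_equiv_eq; rewrite /tops /= tree_root_child_l.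
  by case: asboolP => // kp; split.
have -> : (`[< tops (child_r Q) >])%:R = (`[< ~ keep (tree_root Q) Q >])%:R :> R.
  congr (nat_of_bool _)%:R; apply/asbool_equiv_eq; rewrite /tops /= tree_root_child_r.
  by case: asboolP => // kp; split.
rewrite tree_root_child_l tree_root_child_r dlen_child_l dlen_child_r.
have [kp|nkp] := asboolP (keep (tree_root Q) Q).
  rewrite (asboolF (P := ~ _)); last by move=> /(_ kp).
  have [nb nbl nbr _ _] := kp.
  rewrite (asboolF nb) (asboolF nbl) (asboolF nbr) !mul0r !add0r mulr0 !subr0 -/v.
  move=> IHl IHr _ _ ->; rewrite [_ * (_ + energy _ _)]mulrDr.
  by move: (_ * energy _ _) (_ * energy _ _) IHl IHr => x y; lra.
rewrite (asboolT nkp) mul1r -(energy_restart v (child_l Q)) -(energy_restart v (child_r Q)).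
rewrite dlen_child_l dlen_child_r => IHl IHr bl br ->.
set dl := enorm (dslope (child_l Q) - v); set dr := enorm (dslope (child_r Q) - v).
have -> x y : 2 * eps ^- 2 * (x + dlen R Q / 2 * dl ^+ 2 + (y + dlen R Q / 2 * dr ^+ 2))
   = 2 * eps ^- 2 * x + 2 * eps ^- 2 * y + dlen R Q * (eps ^- 2 * dl ^+ 2)
     + dlen R Q * (eps ^- 2 * dr ^+ 2) by field; rewrite gt_eqF.
have jump d : eps < d -> dlen R Q <= dlen R Q * (eps ^- 2 * d ^+ 2).
  move=> ed; rewrite -[leLHS]mulr1 ler_wpM2l ?(ltW l0) // mulrC ler_pdivlMr // mul1r.
  by rewrite ler_pXn2r ?nnegrE ?ltW // (lt_trans eps_gt0).
have dev_ge0 d : 0 <= dlen R Q * (eps ^- 2 * d ^+ 2).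
  exact: mulr_ge0 (ltW l0) (mulr_ge0 (ltW ei) (sqr_ge0 d)).
have charge : dlen R Q <= dlen R Q * (eps ^- 2 * dl ^+ 2) + dlen R Q * (eps ^- 2 * dr ^+ 2)
    + (`[< bad Q >])%:R * dlen R Q + 2 * ((`[< bad (child_l Q) >])%:R * (dlen R Q / 2))
    + 2 * ((`[< bad (child_r Q) >])%:R * (dlen R Q / 2)).
  move: (jump dl) (dev_ge0 dl) (jump dr) (dev_ge0 dr).
  move: (dlen R Q * (_ * dl ^+ 2)) (dlen R Q * (_ * dr ^+ 2)) => ql qr Jl ql0 Jr qr0.
  have [bQ|nbQ] := asboolP (bad Q); first by rewrite ?mul0r mul1r; move: bl br; lra.
  have [bc|nbl] := asboolP (bad (child_l Q)); first by rewrite ?mul0r mul1r; move: bl br; lra.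
  have [bc|nbr] := asboolP (bad (child_r Q)); first by rewrite ?mul0r mul1r; move: bl br; lra.
  rewrite !mul0r !mulr0 !addr0; have [ed|/Jl] := lerP dl eps; last by lra.
  have [ed'|/Jr] := lerP dr eps; last by lra.
  by case: nkp.
move: charge IHl IHr; move: (_ * energy _ _) (_ * energy _ _) => pl pr.
move: (_ * (_ * dl ^+ 2)) (_ * (_ * dr ^+ 2)) (_ * dlen R Q) => ql qr bq.
move: (_ * (dlen R Q / 2)) (_ * (dlen R Q / 2)) bl br => xl xr.
by move=> *; lra.
Qed.

Definition corona_const : R := 1 + 2 * eps ^- 2 * 5 + 3 * bad_const.

Lemma energy_le v Q : enorm v <= 1 -> energy v Q <= 5 * dlen R Q.
Proof.
move=> v1; have l0 := dlen_gt0 R Q; rewrite /energy [leRHS]mulrC ler_pM2l //.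
have := enormB (dslope Q) v; have := dslope_le1 Q.
have := enorm_ge0 (dslope Q); have := enorm_ge0 (dslope Q - v).
by move: (enorm _) (enorm _) (enorm v) v1 => x y z *; nra.
Qed.

Lemma subsum_tops J Q : subsum R tops J Q <= corona_const * dlen R Q.
Proof.
have l0 := dlen_gt0 R Q; have ei : 0 < eps ^- 2 by rewrite invr_gt0 exprn_gt0.
have nc : 0 <= nonflat_const.
  by rewrite mulr_ge0 ?addr_ge0 ?mulr_ge0 ?ler0n // invr_ge0 sqr_ge0.
have C0 : 0 <= 2 * eps ^- 2 * 5 + 3 * bad_const by rewrite /bad_const; nra.
case: J => [|J]; first by rewrite mulr_ge0 ?ltW // /corona_const; lra.
have le_ind : (`[< tops Q >])%:R * dlen R Q <= dlen R Q.
  by rewrite -[leRHS]mul1r ler_pM2r // lern1; case: (`[< _ >]).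
have -> : subsum R tops J.+1 Q = (`[< tops Q >])%:R * dlen R Q +
  (subsum R tops J (child_l Q) + subsum R tops J (child_r Q)) by rewrite /= addrA.
have He : 2 * eps ^- 2 * energy (dslope (tree_root Q)) Q <= 2 * eps ^- 2 * (5 * dlen R Q).
  by rewrite ler_wpM2l ?energy_le ?dslope_le1 // mulr_ge0 // ltW.
apply: le_trans (lerD le_ind (subsum_tops_below J Q)) _.
have -> : corona_const * dlen R Q =
    dlen R Q + (2 * eps ^- 2 * (5 * dlen R Q) + 3 * (bad_const * dlen R Q)).
  by rewrite /corona_const; ring.
rewrite lerD2l; apply: le_trans (_ : _ <= 2 * eps ^- 2 * energy (dslope (tree_root Q)) Q
   + 3 * subsum R bad J.+1 Q) _; first by rewrite gerBl mulr_ge0 ?ind_len_ge0.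
by rewrite lerD // ler_wpM2l ?subsum_bad.
Qed.

Lemma coronization_exists (C : R) :
  bad_const <= C -> corona_const <= C ->
  coronization C (~` bad) bad forest.
Proof.
move=> badC coronaC; split.
- by split; [rewrite setUC setUv | rewrite setIC setICr].
- move=> Q0; apply: esum_le_subsum => J; apply: le_trans (subsum_bad _ _) _.
  by rewrite ler_wpM2r // ltW // dlen_gt0.
- split=> [_ [P tP <-]||]; first exact: tree_is_tree.
    apply/trivIsetP => _ _ [P tP <-] [P' tP' <-] neq.
    rewrite -subset0 => Q [[_ E] [_ E']]; move/eqP: neq; apply.
    by rewrite -E -E'.
  apply/seteqP; split=> [Q [_ [P tP <-] []] //|Q nbQ].
  have TQ : tree (tree_root Q) Q by [].
  exists (tree (tree_root Q)) => //; exists (tree_root Q) => //.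
  by have [j jE /(_ j (leqnn j))] := tree_anc TQ; rewrite -jE.
- move=> Q0.
  pose A := [set P | top_set P /\ dset R P `<=` dset R Q0].
  have bij : set_bij A [set T | forest T /\ dset R (tree_top R T) `<=` dset R Q0] tree.
    split.
    - by move=> P [tP sub]; split; [exists P | rewrite tree_topE].
    - move=> P P' /set_mem[tP _] /set_mem[tP' _] E.
      by rewrite -(tree_topE tP) E tree_topE.
    - by move=> _ [[P tP <-] sub]; exists P => //; split; rewrite // tree_topE in sub.
  rewrite (reindex_esum _ _ _ _ bij).
  rewrite (eq_esum (b := fun P => (dlen R P)%:E)); last first.
    by move=> P [tP _]; rewrite /= tree_topE.
  apply: esum_le_subsum => J.
  apply: le_trans (@subsum_le R _ tops J Q0 _) _; first by move=> P [].
  apply: le_trans (subsum_tops _ _) _.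
  by rewrite ler_wpM2r // ltW // dlen_gt0.
Qed.

End Coronization.

(** * Horizontal curves and their signed area *)

Section Subdivision.
Variable R : realType.

(** An error that is quadratic in the step disappears under subdivision. *)
Lemma subdivision (F : R -> R) (a b A B : R) : a <= b ->
  (forall s s', a <= s <= b -> a <= s' <= b ->
     `|F s - F s'| <= A * `|s - s'| + B * `|s - s'| ^+ 2) ->
  `|F b - F a| <= A * (b - a).
Proof.
move=> ab HF.
have step n : (0 < n)%N -> `|F b - F a| <= A * (b - a) + B * (b - a) ^+ 2 / n%:R.
  move=> n0; have nR : 0 < n%:R :> R by rewrite ltr0n.
  pose d := (b - a) / n%:R; pose t i : R := a + i%:R * d.
  have d0 : 0 <= d by rewrite divr_ge0 ?subr_ge0 // ltW.
  have nd : n%:R * d = b - a by rewrite mulrCA divff ?mulr1 // gt_eqF.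
  have tin i : (i <= n)%N -> a <= t i <= b.
    move=> i_n; rewrite /t lerDl mulr_ge0 ?ler0n //=.
    by rewrite -lerBrDl -nd ler_wpM2r // ler_nat.
  have tS i : t i.+1 - t i = d by rewrite /t -natr1; ring.
  have -> : F b - F a = \sum_(0 <= i < n) (F (t i.+1) - F (t i)).
    by rewrite telescope_sumr // /t nd mul0r addr0 [a + _]addrC subrK.
  apply: le_trans (ler_norm_sum _ _ _) _.
  apply: le_trans (_ : \sum_(0 <= i < n) (A * d + B * d ^+ 2) <= _).
    rewrite !big_mkord; apply: ler_sum => i _.
    have := HF (t i.+1) (t i) (tin _ (ltn_ord i)) (tin _ (ltnW (ltn_ord i))).
    by rewrite tS (ger0_norm d0).
  rewrite sumr_const_nat subn0 -[leLHS]mulr_natl mulrDr mulrCA nd lerD2l.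
  by rewrite /d le_eqVlt; apply/orP; left; apply/eqP; field; rewrite gt_eqF.
rewrite leNgt; apply/negP => lt_F.
set x := _ - _ in step lt_F; set e := `|x| - A * (b - a).
have e0 : 0 < e by rewrite subr_gt0.
set c := B * (b - a) ^+ 2 in step.
have [n0] : exists n : nat, `|c| / e < n%:R.
  by exists (Num.truncn (`|c| / e)).+1; rewrite truncnS_gt.
rewrite ltr_pdivrMr // => ltn.
have nR : 0 < n0.+1%:R :> R by rewrite ltr0n.
have := step n0.+1 isT; rewrite -lerBlDl -/e ler_pdivlMr //.
have := ler_norm c; rewrite -natr1 mulrDr mulr1; lra.
Qed.

End Subdivision.

(** What the vertical component of the group law uses: a bounded skew form om
    and a bounded linear form g, the coordinate conjugate to the graph variable. *)
Record area_form (R : realType) (k : nat)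
    (om : 'rV[R]_k -> 'rV[R]_k -> R) (g : 'rV[R]_k -> R) (w : R) : Prop := AreaForm {
  form_addl : forall u v z, om (u + v) z = om u z + om v z;
  form_scalel : forall a u z, om (a *: u) z = a * om u z;
  form_skew : forall u z, om u z = - om z u;
  form_le : forall u z, `|om u z| <= w * (enorm u * enorm z);
  form_bound_ge0 : 0 <= w;
  lin_add : forall u v, g (u + v) = g u + g v;
  lin_scale : forall a u, g (a *: u) = a * g u;
  lin_le : forall u, `|g u| <= enorm u }.

Section Horizontal.
Variables (R : realType) (k : nat).
Local Notation E := 'rV[R]_k.
Variables (om : E -> E -> R) (g : E -> R) (w : R).
Hypothesis HA : area_form om g w.
Let omDl := form_addl HA.
Let omZl := form_scalel HA.
Let omC := form_skew HA.
Let om_le := form_le HA.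
Let w_ge0 := form_bound_ge0 HA.
Let gD := lin_add HA.
Let gZ := lin_scale HA.
Let g_le := lin_le HA.

Lemma omNl u z : om (- u) z = - om u z.
Proof. by rewrite -scaleN1r omZl mulN1r. Qed.
Lemma omDr u v z : om z (u + v) = om z u + om z v.
Proof. by rewrite omC omDl opprD -!omC. Qed.
Lemma omZr a u z : om z (a *: u) = a * om z u.
Proof. by rewrite omC omZl -mulrN -omC. Qed.
Lemma omNr u z : om z (- u) = - om z u.
Proof. by rewrite omC omNl -omC. Qed.
Lemma om_diag u : om u u = 0.
Proof. by have := omC u u; lra. Qed.
Lemma gN u : g (- u) = - g u.
Proof. by rewrite -scaleN1r gZ mulN1r. Qed.

(** The vertical component of the displacement from s' to s along the graph of
    (f, tau), seen from the point over s'. *)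
Definition defect (f : R -> E) (tau : R -> R) (s' s : R) : R :=
  tau s - tau s' + (s - s') * g (f s') - 2^-1 * om (f s') (f s).

Definition horizontal (K : R) (f : R -> E) (tau : R -> R) : Prop :=
  forall s' s, `|defect f tau s' s| <= K * `|s - s'| ^+ 2.

(** The vertical component of the displacement between two graphs over s. *)
Definition gap (f : R -> E) (tau : R -> R) (f2 : R -> E) (tau2 : R -> R) (s : R) : R :=
  tau s - tau2 s - 2^-1 * om (f2 s) (f s).

Lemma gap_increment f tau f2 tau2 s' s :
  gap f tau f2 tau2 s - gap f tau f2 tau2 s' =
  defect f tau s' s - defect f2 tau2 s' s - (s - s') * g (f s' - f2 s')
  + 2^-1 * (om (f s - f2 s + (f s' - f2 s')) (f2 s - f2 s')
            + om (f s' - f2 s') ((f s - f2 s) - (f s' - f2 s'))).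
Proof.
rewrite /gap /defect !(omDl, omDr, omNl, omNr, gD, gN) !om_diag.
rewrite ?(omC (f2 s) (f s)) ?(omC (f2 s) (f s')) ?(omC (f2 s) (f2 s')).
by rewrite ?(omC (f2 s') (f s)) ?(omC (f2 s') (f s')) ?(omC (f s') (f s)); field.
Qed.

Definition gap_const : R := 1 + 4 * w.

(** The increment of the gap is linear in f - f2 to first order, and the quadratic
    terms, with the constants K and K2, vanish under subdivision. *)
Lemma gap_le (f f2 : R -> E) tau tau2 (a b rho K K2 : R) : a <= b -> 0 <= rho ->
  elipschitz 1 f -> elipschitz 2 f2 -> horizontal K f tau -> horizontal K2 f2 tau2 ->
  (forall s, a <= s <= b -> enorm (f s - f2 s) <= rho) ->
  `|gap f tau f2 tau2 b - gap f tau f2 tau2 a| <= gap_const * rho * (b - a).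
Proof.
move=> ab r0 lf lf2 hf hf2 close.
apply: (@subdivision _ _ _ _ _ (K + K2)) => // s s' sab sab'.
rewrite gap_increment; set d := `|s - s'|.
have := hf s' s; have := hf2 s' s; rewrite -/d => D2 D1.
have cs := close s sab; have cs' := close s' sab'.
have d0 : 0 <= d by exact: normr_ge0.
have G : `|(s - s') * g (f s' - f2 s')| <= d * rho.
  by rewrite normrM ler_wpM2l //; apply: le_trans (g_le _) cs'.
have O1 : `|om (f s - f2 s + (f s' - f2 s')) (f2 s - f2 s')| <= w * (2 * rho * (2 * d)).
  apply: le_trans (om_le _ _) _; rewrite ler_wpM2l //.
  apply: ler_pM; rewrite ?enorm_ge0 //.
  by apply: le_trans (enormD _ _) _; lra.
have O2 : `|om (f s' - f2 s') ((f s - f2 s) - (f s' - f2 s'))| <= w * (rho * (3 * d)).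
  apply: le_trans (om_le _ _) _; rewrite ler_wpM2l //.
  apply: ler_pM; rewrite ?enorm_ge0 //.
  have -> : f s - f2 s - (f s' - f2 s') = (f s - f s') - (f2 s - f2 s').
    by apply/rowP => i; rewrite !mxE; ring.
  apply: le_trans (enormB _ _) _.
  by have := lf s s'; have := lf2 s s'; rewrite -/d; lra.
move: G O1 O2 D1 D2; rewrite !ler_norml /gap_const.
have : 0 <= w * (rho * d) by rewrite !mulr_ge0.
move: (defect _ _ _ _) (defect _ _ _ _) (om _ _) (om _ _) ((s - s') * _).
by move=> x y z t v W /andP[? ?] /andP[? ?] /andP[? ?] /andP[? ?] /andP[? ?]; apply/andP; split; lra.
Qed.

Lemma defect_chain f tau s0 s1 s2 :
  defect f tau s0 s2 = defect f tau s0 s1 + defect f tau s1 s2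
    + (s2 - s1) * g (f s0 - f s1) - 2^-1 * om (f s0 - f s1) (f s2 - f s1).
Proof.
rewrite /defect !(omDl, omDr, omNl, omNr, gD, gN) !om_diag.
by rewrite ?(omC (f s1) (f s0)) ?(omC (f s2) (f s0)) ?(omC (f s2) (f s1)); field.
Qed.

Lemma defect_chain_le f tau (K K' : R) s0 s1 s2 : elipschitz 2 f ->
  s0 <= s1 <= s2 \/ s2 <= s1 <= s0 -> 0 <= K -> 0 <= K' ->
  `|defect f tau s0 s1| <= K * `|s1 - s0| ^+ 2 ->
  `|defect f tau s1 s2| <= K' * `|s2 - s1| ^+ 2 ->
  `|defect f tau s0 s2| <= (K + K' + 2 + 2 * w) * `|s2 - s0| ^+ 2.
Proof.
move=> lf ord K0 K0' h1 h2.
set d1 := `|s1 - s0| in h1 *; set d2 := `|s2 - s1| in h2 *.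
have -> : `|s2 - s0| = d1 + d2.
  rewrite /d1 /d2; case: ord => /andP[c1 c2].
    by rewrite !ger0_norm; lra.
  by rewrite !ler0_norm; lra.
have d10 : 0 <= d1 by exact: normr_ge0.
have d20 : 0 <= d2 by exact: normr_ge0.
have l01 : enorm (f s0 - f s1) <= 2 * d1 by rewrite /d1 distrC.
have l12 : enorm (f s2 - f s1) <= 2 * d2 by exact: lf.
have G : `|(s2 - s1) * g (f s0 - f s1)| <= d2 * (2 * d1).
  by rewrite normrM ler_wpM2l //; apply: le_trans (g_le _) l01.
have O : `|om (f s0 - f s1) (f s2 - f s1)| <= w * (2 * d1 * (2 * d2)).
  apply: le_trans (om_le _ _) _; rewrite ler_wpM2l //.
  by apply: ler_pM; rewrite ?enorm_ge0.
rewrite (defect_chain f tau s0 s1 s2); move: G O h1 h2; rewrite !ler_norml.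
move: (defect _ _ _ _) (defect _ _ _ _) (om _ _) ((s2 - s1) * _) => x y z v.
have P1 : 0 <= K * (d2 * d2 + 2 * (d1 * d2)) by rewrite !(mulr_ge0, addr_ge0).
have P2 : 0 <= K' * (d1 * d1 + 2 * (d1 * d2)) by rewrite !(mulr_ge0, addr_ge0).
have P3 : 0 <= w * (d1 * d1 + d2 * d2 + d1 * d2) by rewrite !(mulr_ge0, addr_ge0).
have P4 : 0 <= d1 * d1 + d2 * d2 + d1 * d2 by rewrite !(mulr_ge0, addr_ge0).
have P5 : 0 <= w * (d1 * d2) by rewrite !mulr_ge0.
have P6 : 0 <= d1 * d2 by rewrite !mulr_ge0.
by move=> /andP[? ?] /andP[? ?] /andP[? ?] /andP[? ?]; apply/andP; split; lra.
Qed.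

End Horizontal.

(** * Segments with prescribed area *)

Section Bump.
Variable R : realType.
Implicit Types x y : R.

Definition clamp x : R := Num.max 0 (Num.min x 1).

(** The bump has integral 1 and is Lipschitz, so that kappa times a rescaled bump
    adds the area kappa and stays a small Lipschitz perturbation. *)
Definition bump x : R := 6 * clamp x * (1 - clamp x).
Definition bump_primitive x : R := clamp x ^+ 2 * (3 - 2 * clamp x).

Lemma clampP x :
  [\/ x <= 0 /\ clamp x = 0, 0 <= x <= 1 /\ clamp x = x | 1 <= x /\ clamp x = 1].
Proof.
rewrite /clamp; have [x1|x1] := lerP x 1.
  by have [x0|x0] := lerP 0 x; [apply: Or32 | apply: Or31; rewrite ltW].
by rewrite (max_idPr ler01); apply: Or33; rewrite ltW.
Qed.

Lemma clamp_lip x y : `|clamp x - clamp y| <= `|x - y|.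
Proof.
rewrite ler_norml; have := ler_norm (x - y); have := ler_norm (- (x - y)).
by rewrite normrN; case: (clampP x) => -[hx ->]; case: (clampP y) => -[hy ->];
  move=> *; apply/andP; split; lra.
Qed.

Lemma bump_lip x y : `|bump x - bump y| <= 6 * `|x - y|.
Proof.
have cd := clamp_lip x y.
have -> : bump x - bump y = 6 * ((clamp x - clamp y) * (1 - clamp x - clamp y)).
  by rewrite /bump; ring.
rewrite normrM ger0_norm // ler_pM2l // normrM -[leRHS]mulr1 ler_pM //.
by rewrite ler_norml; case: (clampP x) => -[hx ->]; case: (clampP y) => -[hy ->];
  apply/andP; split; lra.
Qed.

Lemma bump_primitive_taylor x y :
  `|bump_primitive x - bump_primitive y - (x - y) * bump y| <= 6 * `|x - y| ^+ 2.
Proof.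
rewrite real_normK ?num_real //; set c := clamp x; set d := clamp y.
have -> : bump_primitive x - bump_primitive y - (x - y) * bump y =
    (c - d) ^+ 2 * (3 - 2 * c - 4 * d) - (x - y - (c - d)) * (6 * d * (1 - d)).
  by rewrite /bump /bump_primitive -/c -/d; ring.
have c01 : 0 <= c <= 1 by rewrite /c; case: (clampP x) => -[hx ->]; lra.
have d01 : 0 <= d <= 1 by rewrite /d; case: (clampP y) => -[hy ->]; lra.
have cd : (c - d) ^+ 2 <= (x - y) ^+ 2.
  rewrite -[leLHS]real_normK ?num_real // -[leRHS]real_normK ?num_real //.
  by apply: lerXn2r; rewrite ?nnegrE //; exact: clamp_lip.
have H1 : `|(c - d) ^+ 2 * (3 - 2 * c - 4 * d)| <= 3 * (x - y) ^+ 2.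
  rewrite normrM ger0_norm ?sqr_ge0 // mulrC.
  by apply: ler_pM => //; rewrite ?sqr_ge0 // ler_norml; apply/andP; split; lra.
have H2 : `|(x - y - (c - d)) * (6 * d * (1 - d))| <= 3 * (x - y) ^+ 2.
  rewrite ler_norml /c /d.
  have xy0 := sqr_ge0 (x - y); case: (clampP y) => -[hy ->].
  - by rewrite mulr0 mul0r mulr0; apply/andP; split; lra.
  - have /andP[y0 y1] := hy; have yy : 0 <= y * (1 - y) by rewrite mulr_ge0 ?subr_ge0.
  have yy1 : y * (1 - y) <= y by have := sqr_ge0 y; lra.
  have yy2 : y * (1 - y) <= 1 - y by have := sqr_ge0 (1 - y); lra.
  case: (clampP x) => -[hx ->].
  * have x0 : 0 <= - x by lra.
    have h1 := mulr_ge0 x0 yy; have h2 := ler_wpM2l x0 yy1.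
    by have := sqr_ge0 (x + y); move=> *; apply/andP; split; nra.
  * by rewrite subrr mul0r; apply/andP; split; lra.
  * have x0 : 0 <= x - 1 by lra.
    have h1 := mulr_ge0 x0 yy; have h2 := ler_wpM2l x0 yy2.
    by have := sqr_ge0 (x + y - 2); move=> *; apply/andP; split; nra.
  - by rewrite subrr !mulr0; apply/andP; split; lra.
by apply: le_trans (ler_normB _ _) _; lra.
Qed.

Lemma clamp0 : clamp 0 = 0.
Proof. by case: (clampP 0) => -[]; rewrite ?lexx // => h ->; move: h; lra. Qed.

Lemma clamp1 : clamp 1 = 1.
Proof. by case: (clampP 1) => -[]; rewrite ?lexx // => h ->; move: h; lra. Qed.

End Bump.

Section Segment.
Variables (R : realType) (k : nat).
Local Notation E := 'rV[R]_k.
Variables (om : E -> E -> R) (g : E -> R) (w : R).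
Hypothesis HA : area_form om g w.
Variable e : E.
Hypotheses (g_e : g e = 1) (om_e : forall v, om e v = 0) (enorm_e : enorm e = 1).
Variables (f : R -> E) (tau : R -> R).
Hypotheses (f_lip : elipschitz 1 f).

(** The chord of f over [a, a + l], bent in the direction e by a bump of area
    kappa, together with its horizontal lift starting at tau a. *)
Definition seg (kappa a l s : R) : E :=
  f a + (s - a) *: slope f a l + (kappa / l * bump ((s - a) / l)) *: e.

Definition seg_lift (kappa a l s : R) : R :=
  tau a - (g (f a) * (s - a) + g (slope f a l) / 2 * (s - a) ^+ 2)
  - kappa * bump_primitive ((s - a) / l)
  + 2^-1 * om (f a) (slope f a l) * (s - a).

(** The bump area for which the lift ends at tau (a + l). *)
Definition area_defect (a l : R) : R := seg_lift 0 a l (a + l) - tau (a + l).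

Section OneSegment.
Variables (a l : R).
Hypothesis l_gt0 : 0 < l.

Lemma seg_start kappa : seg kappa a l a = f a.
Proof.
by rewrite /seg subrr mul0r scale0r /bump clamp0 mulr0 mul0r mulr0 scale0r !addr0.
Qed.

Lemma seg_end kappa : seg kappa a l (a + l) = f (a + l).
Proof.
rewrite /seg [a + l - a]addrC addKr divff ?gt_eqF // /bump clamp1 subrr !mulr0 scale0r.
by rewrite addr0 slopeE // addrC subrK.
Qed.

Lemma seg_lift_start kappa : seg_lift kappa a l a = tau a.
Proof. by rewrite /seg_lift subrr mul0r /bump_primitive clamp0; ring. Qed.

Lemma seg_lift_end : seg_lift (area_defect a l) a l (a + l) = tau (a + l).
Proof.
rewrite /area_defect /seg_lift [a + l - a]addrC addKr divff ?gt_eqF //.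
by rewrite /bump_primitive clamp1; ring.
Qed.

Lemma seg_slope kappa s s' :
  enorm (seg kappa a l s - seg kappa a l s' - (s - s') *: slope f a l)
    <= 6 * `|kappa| / l ^+ 2 * `|s - s'|.
Proof.
have -> : seg kappa a l s - seg kappa a l s' - (s - s') *: slope f a l =
    (kappa / l * (bump ((s - a) / l) - bump ((s' - a) / l))) *: e.
  by rewrite /seg; apply/rowP => i; rewrite !mxE; ring.
have li : 0 < l^-1 by rewrite invr_gt0.
rewrite enormZ enorm_e mulr1 !normrM (gtr0_norm li).
have := bump_lip ((s - a) / l) ((s' - a) / l).
have -> : (s - a) / l - (s' - a) / l = (s - s') / l by field; rewrite gt_eqF.
rewrite normrM (gtr0_norm li) => H.
have -> : 6 * `|kappa| / l ^+ 2 * `|s - s'| =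
    `|kappa| / l * (6 * (`|s - s'| / l)) by field; rewrite gt_eqF.
by apply: ler_wpM2l H; rewrite divr_ge0 // ltW.
Qed.

Lemma seg_horizontal kappa :
  horizontal om g (1 + 6 * `|kappa| / l ^+ 2) (seg kappa a l) (seg_lift kappa a l).
Proof.
move=> s' s; set x := (s - a) / l; set y := (s' - a) / l.
set m := slope f a l; have lN0 : l != 0 by rewrite gt_eqF.
have -> : defect om g (seg kappa a l) (seg_lift kappa a l) s' s =
    - (g m / 2 * (s - s') ^+ 2)
    - kappa * (bump_primitive x - bump_primitive y - (x - y) * bump y).
  rewrite /defect /seg /seg_lift -/x -/y -/m; clearbody m.
  rewrite !(lin_add HA, lin_scale HA) g_e.
  rewrite !(form_addl HA, form_scalel HA, omDr HA, omZr HA) !(om_e, form_skew HA _ e).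
  rewrite !(om_diag HA) ?(form_skew HA m (f a)).
  have -> : x - y = (s - s') / l by rewrite /x /y; field.
  by field.
have := bump_primitive_taylor x y.
have -> : x - y = (s - s') / l by rewrite /x /y; field.
set t := _ - _ - _ => Ht.
have gm : `|g m| <= 1 by apply: le_trans (lin_le HA _) (slope_le1 f_lip _ l_gt0).
rewrite mulrDl mul1r; apply: le_trans (ler_normD _ _) _; rewrite !normrN.
apply: lerD.
  rewrite normrM normrX ler_piMl ?exprn_ge0 // normrM (ger0_norm (x := 2^-1)) //.
  by rewrite ler_pdivrMr //; lra.
rewrite normrM; have -> : 6 * `|kappa| / l ^+ 2 * `|s - s'| ^+ 2 =
    `|kappa| * (6 * `|(s - s') / l| ^+ 2).
  by rewrite normrM (gtr0_norm (x := l^-1)) ?invr_gt0 //; field.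
by rewrite ler_wpM2l.
Qed.

Hypothesis tau_hor : horizontal om g 1 f tau.

(** The curve and its chord are both horizontal and start at the same point, so
    the defect is the gap between them at the other end. *)
Lemma area_defect_le eps : 0 <= eps -> flat f a (a + l) (eps * l) ->
  `|area_defect a l| <= gap_const w * (2 * eps) * l ^+ 2.
Proof.
move=> e0 [v fv]; have w0 := form_bound_ge0 HA.
have al : a <= a + l by rewrite lerDl ltW.
have m1 : enorm (slope f a l) <= 1 by exact: slope_le1.
have chord2 : elipschitz 2 (seg 0 a l).
  move=> s s'; have := seg_slope 0 s s'; rewrite normr0 mulr0 !mul0r => H.
  have -> : seg 0 a l s - seg 0 a l s' =
      (seg 0 a l s - seg 0 a l s' - (s - s') *: slope f a l) + (s - s') *: slope f a l.
    by rewrite subrK.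
  apply: le_trans (enormD _ _) _; rewrite enormZ.
  have := ler_wpM2l (normr_ge0 (s - s')) m1; rewrite mulr1.
  have := normr_ge0 (s - s'); lra.
have close s : a <= s <= a + l -> enorm (f s - seg 0 a l s) <= 2 * eps * l.
  move=> /andP[as_ sl].
  have fs : enorm (f s - f a - (s - a) *: v) <= eps * l by apply: fv; rewrite ?as_ ?lexx.
  have fe : enorm (f (a + l) - f a - (a + l - a) *: v) <= eps * l.
    by apply: fv; rewrite ?lexx al.
  have -> : f s - seg 0 a l s = (f s - f a - (s - a) *: v)
      - ((s - a) / l) *: (f (a + l) - f a - (a + l - a) *: v).
    rewrite /seg /slope; apply/rowP => i; rewrite !mxE; field.
    by rewrite gt_eqF.
  apply: le_trans (enormB _ _) _.
  have -> : 2 * eps * l = eps * l + eps * l by ring.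
  apply: (lerD fs); rewrite enormZ -[leRHS]mul1r.
  apply: ler_pM; rewrite ?enorm_ge0 // ger0_norm.
    by rewrite ler_pdivrMr // mul1r lerBlDl.
  by rewrite divr_ge0 ?subr_ge0 // ltW.
have := gap_le HA al _ f_lip chord2 tau_hor (seg_horizontal 0) close.
rewrite !mulr_ge0 ?(ltW l_gt0) // => /(_ isT).
rewrite /gap seg_start seg_end !(om_diag HA) seg_lift_start subrr mulr0 !subr0.
rewrite distrC -/(area_defect a l) [a + l - a]addrC addKr.
by move=> H; apply: le_trans H _; rewrite le_eqVlt; apply/orP; left; apply/eqP; ring.
Qed.

End OneSegment.
End Segment.

(** * The approximating graph of a tree *)

Lemma le_of_geometric (R : realType) (x y C : R) :
  (forall j : nat, x <= y + C / (2 ^ j)%:R) -> x <= y.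
Proof.
move=> H; rewrite leNgt; apply/negP => yx.
have d0 : 0 < x - y by rewrite subr_gt0.
pose j := (Num.truncn (`|C| / (x - y))).+1.
have : `|C| / (x - y) < j%:R by exact: truncnS_gt.
rewrite ltr_pdivrMr // => Hj.
have jp : (j%:R : R) <= (2 ^ j)%:R by rewrite ler_nat ltnW // ltn_expl.
have := H j; rewrite -lerBlDl ler_pdivlMr ?pow2_gt0 //.
have := ler_norm C; nra.
Qed.

Section TreeApproximation.
Variables (R : realType) (k : nat).
Local Notation E := 'rV[R]_k.
Variables (om : E -> E -> R) (g : E -> R) (w : R).
Hypothesis HA : area_form om g w.
Variable e : E.
Hypotheses (g_e : g e = 1) (om_e : forall v, om e v = 0) (enorm_e : enorm e = 1).
Variables (f : R -> E) (tau : R -> R).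
Hypotheses (f_lip : elipschitz 1 f) (tau_hor : horizontal om g 1 f tau).
Variable eps : R.
Variables (T : set dyadic) (P : dyadic).
Hypotheses (T_top : T P)
  (T_anc : forall Q, T Q -> exists2 j, P = iter j par Q &
     forall i, (i <= j)%N -> T (iter i par Q))
  (T_children : forall Q, T Q -> (T (child_l Q) <-> T (child_r Q)))
  (T_flat : forall Q, T Q -> wide_flat f eps (dlo R Q) (dlen R Q))
  (T_slope : forall Q, T Q -> enorm (dslope f Q - dslope f P) <= eps).

Local Notation lo := (dlo R).
Local Notation hi := (dhi R).
Local Notation len := (dlen R).

Definition leaf (Q : dyadic) : Prop := T Q /\ ~ T (child_l Q).
Definition inside (Q : dyadic) (s : R) : Prop := lo Q < s < hi Q.

(** The points where the approximation agrees with the given graph. *)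
Definition core (s : R) : Prop :=
  lo P <= s <= hi P /\ forall Q, leaf Q -> ~ inside Q s.

Definition cell (Q : dyadic) : R -> E :=
  seg e f (area_defect om g f tau (lo Q) (len Q)) (lo Q) (len Q).
Definition cell_lift (Q : dyadic) : R -> R :=
  seg_lift om g f tau (area_defect om g f tau (lo Q) (len Q)) (lo Q) (len Q).

(** The default is the top of the tree, whose segment continues the graph
    outside of the top interval. *)
Definition leaf_at (s : R) : dyadic := xget P [set Q | leaf Q /\ inside Q s].

Definition interp (s : R) : E :=
  if `[< core s >] then f s else cell (leaf_at s) s.
Definition interp_lift (s : R) : R :=
  if `[< core s >] then tau s else cell_lift (leaf_at s) s.

Lemma lo_lt_hi Q : lo Q < hi Q.
Proof. by rewrite /dhi ltrDl dlen_gt0. Qed.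

(** Were the leaf L strictly larger than Q, then the child of L that contains Q
    would lie between Q and the top, hence in the tree. *)
Lemma leaf_nested Q L : T Q -> leaf L -> lo Q < hi L -> lo L < hi Q ->
  lo Q <= lo L /\ hi L <= hi Q.
Proof.
move=> TQ [TL nL] QL LQ; pose t := Num.max (lo Q) (lo L).
have Qt : dset R Q t by apply/dsetE; rewrite le_max lexx gt_max lo_lt_hi LQ.
have Lt : dset R L t by apply/dsetE; rewrite le_max lexx orbT gt_max lo_lt_hi QL.
have [le_lev|le_lev] := lerP L.1 Q.1.
  have [j ->] := dyadic_nested le_lev Lt Qt.
  by split; [exact: dlo_anc | exact: dhi_anc].
have [[|j] jE] := dyadic_nested (ltW le_lev) Qt Lt; first by rewrite jE.
have [i iE Hi] := T_anc TQ; have [i' i'E _] := T_anc TL.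
have ji : (j <= i)%N.
  have := congr1 fst i'E; rewrite {1}iE jE !anc_level /=; lia.
have Tc := Hi j ji; case: nL; rewrite jE /=.
have Tp : T (par (iter j par Q)) by rewrite -[par _]/(iter j.+1 par Q) -jE.
case: (child_of_par (iter j par Q)) => cE; first by rewrite -cE.
by apply/(T_children Tp); rewrite -cE.
Qed.

Lemma tree_in_top Q : T Q -> lo P <= lo Q /\ hi Q <= hi P.
Proof. by move=> /T_anc[j -> _]; split; [exact: dlo_anc | exact: dhi_anc]. Qed.

Lemma core_ends Q : T Q -> core (lo Q) /\ core (hi Q).
Proof.
move=> TQ; have [h1 h2] := tree_in_top TQ; have lh := lo_lt_hi Q.
split; split.
- by rewrite h1 (le_trans (ltW lh)).
- move=> L lL /andP[a b]; have := leaf_nested TQ lL b (lt_trans a lh).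
  by case=> + _; rewrite leNgt a.
- by rewrite h2 (le_trans h1 (ltW lh)).
- move=> L lL /andP[a b]; have := leaf_nested TQ lL (lt_trans lh b) a.
  by case=> _; rewrite leNgt b.
Qed.

Lemma interp_core s : core s -> interp s = f s /\ interp_lift s = tau s.
Proof. by move=> cs; rewrite /interp /interp_lift asboolT. Qed.

Lemma interp_end Q s : T Q -> s = lo Q \/ s = hi Q ->
  interp s = cell Q s /\ interp_lift s = cell_lift Q s.
Proof.
move=> TQ; have [cl ch] := core_ends TQ; have l0 := dlen_gt0 R Q.
case=> ->; [have [-> ->] := interp_core cl | have [-> ->] := interp_core ch].
  by rewrite /cell /cell_lift seg_start seg_lift_start.
by rewrite /cell /cell_lift /dhi seg_end // seg_lift_end.
Qed.

Lemma interp_leaf L s : leaf L -> lo L <= s <= hi L ->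
  interp s = cell L s /\ interp_lift s = cell_lift L s.
Proof.
move=> lL; have [TL _] := lL; rewrite !le_eqVlt => /andP[].
case/orP=> [/eqP <- _|a]; first by apply: interp_end => //; left.
case/orP=> [/eqP ->|b]; first by apply: interp_end => //; right.
have ins : inside L s by rewrite /inside a b.
have nc : ~ core s by case=> _ /(_ L lL).
rewrite /interp /interp_lift (asboolF nc) /leaf_at.
case: xgetP => [Q _ [lQ /andP[a' b']]|/(_ L)]; last by case.
have [TQ _] := lQ.
have [h1 h2] := leaf_nested TL lQ (lt_trans a b') (lt_trans a' b).
have [h3 h4] := leaf_nested TQ lL (lt_trans a' b) (lt_trans a b').
suff -> : Q = L by [].
have lE : lo Q = lo L by apply/eqP; rewrite eq_le h1 h3.
apply: (@dset_inj R); apply/seteqP; split=> x /dsetE /andP[x1 x2]; apply/dsetE.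
  by rewrite -lE x1 (lt_le_trans x2).
by rewrite lE x1 (lt_le_trans x2).
Qed.

Lemma interp_out s : s <= lo P \/ hi P <= s ->
  interp s = cell P s /\ interp_lift s = cell_lift P s.
Proof.
case: (pselect (s = lo P \/ s = hi P)) => [sE _|nE out]; first exact: interp_end.
have out' : ~ (lo P <= s <= hi P).
  move=> /andP[h1 h2]; apply: nE; case: out => h; [left|right];
  by apply/eqP; rewrite eq_le ?h ?h1 ?h2.
rewrite /interp /interp_lift asboolF; last by case.
rewrite /leaf_at; case: xgetP => // Q _ [[TQ _] /andP[a b]].
have [h1 h2] := tree_in_top TQ; case: out'.
by rewrite (le_trans h1 (ltW a)) (le_trans (ltW b)).
Qed.

Definition linked (s s' : R) : Prop := exists2 Q, T Q &
  (interp s = cell Q s /\ interp_lift s = cell_lift Q s) /\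
  (interp s' = cell Q s' /\ interp_lift s' = cell_lift Q s').

Lemma not_coreP s : ~ core s ->
  [\/ s < lo P, hi P < s | exists2 L, leaf L & inside L s].
Proof.
move=> nc; have [h1|h1] := ltrP s (lo P); first exact: Or31.
have [h2|h2] := ltrP (hi P) s; first exact: Or32.
apply: Or33; apply: contrapT => nL; apply: nc; split; first by rewrite h1.
by move=> L lL ins; apply: nL; exists L.
Qed.

Lemma exit_right s s' : s <= s' -> linked s s' \/
  exists2 s1, s <= s1 <= s' & core s1 /\ (s = s1 \/ linked s s1).
Proof.
move=> ss'; case: (pselect (core s)) => [cs|/not_coreP].
  by right; exists s; [rewrite lexx | split=> //; left].
have [cl ch] := core_ends T_top.
case=> [sl|sh|[L lL /andP[a b]]].
- have [s'l|s'l] := lerP s' (lo P).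
    by left; exists P => //; split; apply: interp_out; left=> //; exact: ltW.
  right; exists (lo P); first by rewrite !ltW.
  split=> //; right; exists P => //; split; apply: interp_out; left=> //; exact: ltW.
- left; exists P => //; split; apply: interp_out; right; first exact: ltW.
  exact: le_trans (ltW sh) ss'.
- have [TL _] := lL; have [s'h|s'h] := lerP s' (hi L).
    left; exists L => //; split; apply: interp_leaf => //; first by rewrite !ltW.
    by rewrite s'h (le_trans (ltW a)).
  right; exists (hi L); first by rewrite !ltW.
  split; first by have [] := core_ends TL.
  right; exists L => //; split; apply: interp_leaf => //; first by rewrite !ltW.
  by rewrite lexx ltW // lo_lt_hi.
Qed.

Lemma exit_left s s' : s <= s' -> linked s s' \/
  exists2 s1, s <= s1 <= s' & core s1 /\ (s1 = s' \/ linked s1 s').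
Proof.
move=> ss'; case: (pselect (core s')) => [cs|/not_coreP].
  by right; exists s'; [rewrite lexx andbT | split=> //; left].
have [cl ch] := core_ends T_top.
case=> [sl|sh|[L lL /andP[a b]]].
- left; exists P => //; split; apply: interp_out; left; last exact: ltW.
  exact: le_trans ss' (ltW sl).
- have [s'l|s'l] := lerP (hi P) s.
    by left; exists P => //; split; apply: interp_out; right=> //; exact: ltW.
  right; exists (hi P); first by rewrite !ltW.
  split=> //; right; exists P => //; split; apply: interp_out; right=> //; exact: ltW.
- have [TL _] := lL; have [s'h|s'h] := lerP (lo L) s.
    left; exists L => //; split; apply: interp_leaf => //; last by rewrite !ltW.
    by rewrite s'h (le_trans ss') // ltW.
  right; exists (lo L); first by rewrite !ltW.
  split; first by have [] := core_ends TL.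
  right; exists L => //; split; apply: interp_leaf => //; last by rewrite !ltW.
  by rewrite lexx ltW // lo_lt_hi.
Qed.

(** Estimates between arbitrary points are thereby reduced to estimates on one
    segment and to estimates between core points, where the graph is the given
    one. *)
Lemma decompose s s' : s <= s' -> exists s1 s2,
  [/\ s <= s1 <= s2, s2 <= s', s = s1 \/ linked s s1,
      s1 = s2 \/ (core s1 /\ core s2) & s2 = s' \/ linked s2 s'].
Proof.
move=> ss'; have [lk|[s1 /andP[h1 h2] [c1 l1]]] := exit_right ss'.
  by exists s', s'; split; rewrite ?ss' ?lexx //; [right | left | left].
have [lk|[s2 /andP[h3 h4] [c2 l2]]] := exit_left h2.
  by exists s1, s1; split; rewrite ?h1 ?lexx //; [left | right].
by exists s1, s2; split; rewrite ?h1 //; right.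
Qed.

(** ** The core increments *)

Hypothesis eps_gt0 : 0 < eps.
Local Notation m := (dslope f P).

Definition dev (s s' : R) : R := enorm (f s - f s' - (s - s') *: m).

Lemma devC s s' : dev s s' = dev s' s.
Proof. by rewrite /dev -enormN; congr enorm; apply/rowP => i; rewrite !mxE; ring. Qed.

Lemma dev_chain s s1 s2 : dev s s2 <= dev s s1 + dev s1 s2.
Proof.
apply: le_trans (enormD _ _); rewrite /dev le_eqVlt; apply/orP; left; apply/eqP.
by congr enorm; apply/rowP => i; rewrite !mxE; ring.
Qed.

Lemma dev_trivial s s' : s' <= s -> dev s s' <= 2 * (s - s').
Proof.
move=> h; have d0 : 0 <= s - s' by rewrite subr_ge0.
apply: le_trans (enormB _ _) _; rewrite enormZ.
have := f_lip s s'; rewrite mul1r ger0_norm // => h1.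
have := ler_wpM2l d0 (dslope_le1 f_lip P); lra.
Qed.

Lemma dev_self s : dev s s = 0.
Proof. by rewrite /dev !subrr scale0r subr0 enorm0. Qed.

Lemma dev_interval Q : T Q -> dev (hi Q) (lo Q) <= eps * len Q.
Proof.
move=> TQ; have l0 := dlen_gt0 R Q.
have -> : dev (hi Q) (lo Q) = len Q * enorm (dslope f Q - m).
  rewrite /dev /dhi -[X in X * _]gtr0_norm // -enormZ scalerBr slopeE //.
  by rewrite [lo Q + _ - _]addrC addKr.
by rewrite mulrC ler_pM2r // T_slope.
Qed.

Lemma leaf_core_ends Q s : T Q -> ~ T (child_l Q) -> core s -> lo Q <= s <= hi Q ->
  s = lo Q \/ s = hi Q.
Proof.
move=> TQ nT [_ /(_ Q (conj TQ nT))]; rewrite /inside !le_eqVlt => ni /andP[].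
case/orP=> [/eqP <- _|a]; first by left.
by case/orP=> [/eqP ->|b]; [right | case: ni; rewrite a b].
Qed.

(** Splitting at the midpoints of the tree intervals telescopes the increment;
    the part that remains after j steps has length at most 2 ^ - j |Q|. *)
Lemma core_dev_lo Q s : T Q -> core s -> lo Q <= s <= hi Q ->
  dev s (lo Q) <= eps * (s - lo Q).
Proof.
move=> TQ cs sQ; apply: (@le_of_geometric _ _ _ (2 * len Q)) => j.
elim: j Q TQ sQ => [|j IHj] Q TQ /andP[h1 h2]; have l0 := dlen_gt0 R Q.
  rewrite divr1; apply: le_trans (dev_trivial h1) _.
  have : 0 <= eps * (s - lo Q) by rewrite mulr_ge0 ?subr_ge0 // ltW.
  by move: h2; rewrite /dhi; lra.
have rest0 : 0 <= 2 * len Q / (2 ^ j.+1)%:R by rewrite divr_ge0 ?ler0n // mulr_ge0 // ltW.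
case: (pselect (T (child_l Q))) => [Tl|nT]; last first.
  case: (leaf_core_ends TQ nT cs) => [|->|->]; first by rewrite h1 h2.
    by rewrite dev_self subrr mulr0 add0r.
  apply: le_trans (dev_interval TQ) _.
  by rewrite /dhi [lo Q + _ - _]addrC addKr lerDl.
have Tr : T (child_r Q) by apply/(T_children TQ).
have rE : len Q / 2 / (2 ^ j)%:R = len Q / (2 ^ j.+1)%:R.
  by rewrite expnS natrM; field; rewrite gt_eqF ?pow2_gt0.
have [sc|sc] := lerP s (hi (child_l Q)).
  have := IHj _ Tl; rewrite dlo_child_l h1 sc => /(_ isT).
  by rewrite dlen_child_l -mulrA rE mulrA.
have := IHj _ Tr; rewrite dlo_child_r dlen_child_r dhi_child_r h2 andbT.
move: sc; rewrite dhi_child_l => sc /(_ (ltW sc)).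
rewrite -mulrA rE mulrA => IH; apply: le_trans (dev_chain _ (lo Q + len Q / 2) _) _.
have := dev_interval Tl; rewrite dhi_child_l dlo_child_l dlen_child_l => Hl.
by apply: le_trans (lerD IH Hl) _; lra.
Qed.

Lemma core_dev_hi Q s : T Q -> core s -> lo Q <= s <= hi Q ->
  dev (hi Q) s <= eps * (hi Q - s).
Proof.
move=> TQ cs sQ; apply: (@le_of_geometric _ _ _ (2 * len Q)) => j.
elim: j Q TQ sQ => [|j IHj] Q TQ /andP[h1 h2]; have l0 := dlen_gt0 R Q.
  rewrite divr1; apply: le_trans (dev_trivial h2) _.
  have : 0 <= eps * (hi Q - s) by rewrite mulr_ge0 ?subr_ge0 // ltW.
  have : hi Q - s <= len Q by rewrite /dhi; lra.
  lra.
have rest0 : 0 <= 2 * len Q / (2 ^ j.+1)%:R by rewrite divr_ge0 ?ler0n // mulr_ge0 // ltW.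
case: (pselect (T (child_l Q))) => [Tl|nT]; last first.
  case: (leaf_core_ends TQ nT cs) => [|->|->]; first by rewrite h1 h2.
    apply: le_trans (dev_interval TQ) _.
    by rewrite /dhi [lo Q + _ - _]addrC addKr lerDl.
  by rewrite dev_self subrr mulr0 add0r.
have Tr : T (child_r Q) by apply/(T_children TQ).
have rE : len Q / 2 / (2 ^ j)%:R = len Q / (2 ^ j.+1)%:R.
  by rewrite expnS natrM; field; rewrite gt_eqF ?pow2_gt0.
have [sc|sc] := lerP (lo (child_r Q)) s.
  have := IHj _ Tr; rewrite dhi_child_r h2 sc => /(_ isT).
  by rewrite dlen_child_r -mulrA rE mulrA.
have := IHj _ Tl; rewrite dhi_child_l dlen_child_l dlo_child_l h1.
move: sc; rewrite dlo_child_r => sc /(_ (ltW sc)).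
rewrite -mulrA rE mulrA => IH; apply: le_trans (dev_chain _ (lo Q + len Q / 2) _) _.
have := dev_interval Tr; rewrite dhi_child_r dlo_child_r dlen_child_r => Hr.
by apply: le_trans (lerD Hr IH) _; rewrite /dhi; lra.
Qed.

(** The two points are separated by a midpoint of a tree interval that contains
    both, at the latest when the intervals get shorter than s' - s; the one-sided
    bounds apply on both sides of this midpoint. *)
Lemma core_dev s s' : core s -> core s' -> s <= s' -> dev s' s <= eps * (s' - s).
Proof.
move=> cs cs'; rewrite le_eqVlt => /orP[/eqP ->|ss'].
  by rewrite dev_self subrr mulr0.
have d0 : 0 < s' - s by rewrite subr_gt0.
have [/andP[h1 _] _] := cs; have [/andP[_ h2] _] := cs'.
have [j Hj] : exists j : nat, len P < (2 ^ j)%:R * (s' - s).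
  pose j := (Num.truncn (len P / (s' - s))).+1; exists j.
  have : len P / (s' - s) < j%:R by exact: truncnS_gt.
  rewrite ltr_pdivrMr // => /lt_le_trans; apply.
  by rewrite ler_pM2r // ler_nat ltnW // ltn_expl.
suff: forall Q, T Q -> lo Q <= s -> s' <= hi Q -> len Q < (2 ^ j)%:R * (s' - s) ->
    dev s' s <= eps * (s' - s) by move/(_ P T_top h1 h2 Hj).
elim: j {Hj} => [|j IHj] Q TQ {}h1 {}h2 Hj.
  by move: h1 h2 Hj; rewrite expn0 mul1r /dhi; lra.
have l0 := dlen_gt0 R Q.
have sQ : lo Q <= s <= hi Q by rewrite h1 (le_trans (ltW ss')).
have s'Q : lo Q <= s' <= hi Q by rewrite h2 (le_trans h1 (ltW ss')).
case: (pselect (T (child_l Q))) => [Tl|nT]; last first.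
  have [E|E] := leaf_core_ends TQ nT cs sQ; last by move: h2; rewrite -E leNgt ss'.
  have [E'|E'] := leaf_core_ends TQ nT cs' s'Q; first by move: h1; rewrite -E' leNgt ss'.
  rewrite E E'; apply: le_trans (dev_interval TQ) _.
  by rewrite {1}/dhi [lo Q + _ - _]addrC addKr.
have Tr : T (child_r Q) by apply/(T_children TQ).
have Hj' : len Q / 2 < (2 ^ j)%:R * (s' - s).
  by rewrite ltr_pdivrMr //; move: Hj; rewrite expnS natrM; lra.
have hE : hi (child_l Q) = lo (child_r Q) by rewrite dhi_child_l dlo_child_r.
have [c1|c1] := lerP s' (hi (child_l Q)).
  by apply: (IHj _ Tl); rewrite ?dlo_child_l ?dlen_child_l.
have [c2|c2] := lerP (lo (child_r Q)) s.
  by apply: (IHj _ Tr); rewrite ?dhi_child_r ?dlen_child_r.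
apply: le_trans (dev_chain _ (lo (child_r Q)) _) _.
have H1 := core_dev_lo Tr cs'; have H2 := core_dev_hi Tl cs.
have := lerD (H1 _) (H2 _); rewrite hE dhi_child_r dlo_child_l h1 h2.
rewrite (ltW c2) -hE (ltW c1) => /(_ isT isT) H; apply: le_trans H _.
by rewrite -mulrDr le_eqVlt; apply/orP; left; apply/eqP; ring.
Qed.

(** ** The approximation is a small perturbation of a linear map *)

(** The first term bounds the deviation of the slopes of the chords from m, the
    second one the bumps. *)
Definition spread : R := eps * (1 + 12 * gap_const w).

Lemma cell_bend Q : T Q ->
  6 * `|area_defect om g f tau (lo Q) (len Q)| / len Q ^+ 2 <= eps * (12 * gap_const w).
Proof.
move=> TQ; have l0 := dlen_gt0 R Q.
have fl : flat f (lo Q) (lo Q + len Q) (eps * len Q).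
  by apply: flat_sub (T_flat TQ) _ _ _; rewrite ?lexx //; lra.
have H := area_defect_le HA g_e om_e enorm_e f_lip l0 tau_hor (ltW eps_gt0) fl.
by rewrite ler_pdivrMr ?exprn_gt0 //; lra.
Qed.

Lemma gap_const_ge1 : 1 <= gap_const w.
Proof. by have := form_bound_ge0 HA; rewrite /gap_const; lra. Qed.

Definition interp_dev s s' : R := enorm (interp s - interp s' - (s - s') *: m).

Lemma linked_dev s s' : linked s s' -> interp_dev s s' <= spread * `|s - s'|.
Proof.
move=> [Q TQ [[E _] [E' _]]]; rewrite /interp_dev E E'.
have l0 := dlen_gt0 R Q.
have H := seg_slope enorm_e f (lo Q) l0 (area_defect om g f tau (lo Q) (len Q)) s s'.
have -> : cell Q s - cell Q s' - (s - s') *: m =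
    (cell Q s - cell Q s' - (s - s') *: dslope f Q) + (s - s') *: (dslope f Q - m).
  by apply/rowP => i; rewrite !mxE; ring.
apply: le_trans (enormD _ _) _; rewrite enormZ.
have H1 := ler_wpM2r (normr_ge0 (s - s')) (cell_bend TQ).
have H2 := ler_wpM2l (normr_ge0 (s - s')) (T_slope TQ).
apply: le_trans (lerD (le_trans H H1) H2) _.
by rewrite /spread; lra.
Qed.

Lemma interp_dev_le s s' : interp_dev s s' <= spread * `|s - s'|.
Proof.
wlog ss' : s s' / s <= s'.
  move=> Hw; have [/Hw //|/ltW/Hw] := leP s s'; rewrite distrC.
  suff -> : interp_dev s' s = interp_dev s s' by [].
  rewrite /interp_dev -enormN; congr enorm.
  by apply/rowP => i; rewrite !mxE; ring.
have self x : interp_dev x x <= spread * `|x - x|.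
  by rewrite /interp_dev !subrr scale0r subr0 enorm0 normr0 mulr0.
have [s1 [s2 [/andP[h1 h2] h3 A B C]]] := decompose ss'.
have {}A : interp_dev s s1 <= spread * `|s - s1|.
  by case: A => [<-|]; [exact: self | exact: linked_dev].
have {}C : interp_dev s2 s' <= spread * `|s2 - s'|.
  by case: C => [<-|]; [exact: self | exact: linked_dev].
have {}B : interp_dev s1 s2 <= spread * `|s1 - s2|.
  case: B => [<-|[c1 c2]]; first exact: self.
  rewrite /interp_dev; have [-> _] := interp_core c1; have [-> _] := interp_core c2.
  rewrite -/(dev s1 s2) devC distrC ger0_norm ?subr_ge0 //.
  apply: le_trans (core_dev c1 c2 h2) _; rewrite ler_wpM2r ?subr_ge0 //.
  rewrite /spread -[leLHS]mulr1 ler_wpM2l ?(ltW eps_gt0) // lerDl.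
  by have := gap_const_ge1; lra.
have -> : `|s - s'| = `|s - s1| + `|s1 - s2| + `|s2 - s'|.
  by rewrite !ler0_norm; lra.
rewrite !mulrDr; apply: le_trans (lerD (lerD A B) C).
apply: le_trans (lerD (enormD _ _) (lexx _)); apply: le_trans (enormD _ _).
rewrite le_eqVlt; apply/orP; left; apply/eqP; congr enorm.
by apply/rowP => i; rewrite !mxE; ring.
Qed.

Hypothesis spread_le1 : spread <= 1.

Lemma interp_lip : elipschitz 2 interp.
Proof.
move=> s s'; rewrite -(subrK ((s - s') *: m) (interp s - interp s')).
apply: le_trans (enormD _ _) _; rewrite enormZ.
have := interp_dev_le s s'; rewrite /interp_dev.
have := ler_wpM2r (normr_ge0 (s - s')) spread_le1.
have := ler_wpM2l (normr_ge0 (s - s')) (dslope_le1 f_lip P); lra.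
Qed.

Lemma defect_self h t (x : R) : defect om g h t x x = 0.
Proof. by rewrite /defect (om_diag HA); ring. Qed.

Lemma linked_defect s s' : linked s s' ->
  `|defect om g interp interp_lift s s'| <= 2 * `|s' - s| ^+ 2 /\
  `|defect om g interp interp_lift s' s| <= 2 * `|s - s'| ^+ 2.
Proof.
move=> [Q TQ [[E F] [E' F']]]; have l0 := dlen_gt0 R Q.
have H x y := seg_horizontal HA g_e om_e tau f_lip (lo Q) l0
  (area_defect om g f tau (lo Q) (len Q)) x y.
have le2 : 1 + 6 * `|area_defect om g f tau (lo Q) (len Q)| / len Q ^+ 2 <= 2.
  have := cell_bend TQ; move: spread_le1 eps_gt0; rewrite /spread; lra.
have dE x y : interp x = cell Q x -> interp y = cell Q y ->
    interp_lift x = cell_lift Q x -> interp_lift y = cell_lift Q y ->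
    defect om g interp interp_lift x y = defect om g (cell Q) (cell_lift Q) x y.
  by rewrite /defect => -> -> -> ->.
split; rewrite dE //; apply: le_trans (H _ _) _; by rewrite ler_wpM2r ?exprn_ge0.
Qed.

(** The defect is additive up to a quadratic error, so the bounds for the three
    steps of a decomposition add up. *)
Lemma interp_horizontal : horizontal om g (9 + 4 * w) interp interp_lift.
Proof.
have w0 := form_bound_ge0 HA; have alip := interp_lip.
pose D := defect om g interp interp_lift.
have self K x : `|D x x| <= K * `|x - x| ^+ 2.
  by rewrite /D defect_self subrr !normr0 expr0n mulr0.
have core_step x y : core x -> core y -> `|D x y| <= 1 * `|y - x| ^+ 2.
  move=> cx cy; have [E F] := interp_core cx; have [E' F'] := interp_core cy.
  by rewrite /D /defect E F E' F'; exact: tau_hor.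
have both s s' : s <= s' -> `|D s s'| <= (9 + 4 * w) * `|s' - s| ^+ 2 /\
    `|D s' s| <= (9 + 4 * w) * `|s - s'| ^+ 2.
  move=> ss'; have [s1 [s2 [/andP[h1 h2] h3 A B C]]] := decompose ss'.
  have [A1 A2] : `|D s s1| <= 2 * `|s1 - s| ^+ 2 /\ `|D s1 s| <= 2 * `|s - s1| ^+ 2.
    by case: A => [<-|/linked_defect[]]; split=> //; exact: self.
  have [C1 C2] : `|D s2 s'| <= 2 * `|s' - s2| ^+ 2 /\ `|D s' s2| <= 2 * `|s2 - s'| ^+ 2.
    by case: C => [<-|/linked_defect[]]; split=> //; exact: self.
  have [B1 B2] : `|D s1 s2| <= 1 * `|s2 - s1| ^+ 2 /\ `|D s2 s1| <= 1 * `|s1 - s2| ^+ 2.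
    case: B => [<-|[c1 c2]]; first by split; exact: self.
    by split; exact: core_step.
  have KE : (2 + 1 + 2 + 2 * w) + 2 + 2 + 2 * w = 9 + 4 * w by ring.
  have KE' : 2 + (1 + 2 + 2 + 2 * w) + 2 + 2 * w = 9 + 4 * w by ring.
  have K0 : 0 <= 2 + 1 + 2 + 2 * w by lra.
  have K0' : 0 <= 1 + 2 + 2 + 2 * w by lra.
  split.
    have S1 : `|D s s2| <= (2 + 1 + 2 + 2 * w) * `|s2 - s| ^+ 2.
      by apply: (defect_chain_le HA alip _ _ _ A1 B1) => //; left; rewrite h1 h2.
    rewrite -KE; apply: (defect_chain_le HA alip _ _ _ S1 C1) => //.
    by left; rewrite h3 (le_trans h1).
  have S1 : `|D s2 s| <= (1 + 2 + 2 + 2 * w) * `|s - s2| ^+ 2.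
    by apply: (defect_chain_le HA alip _ _ _ B2 A2) => //; right; rewrite h1 h2.
  rewrite -KE'; apply: (defect_chain_le HA alip _ _ _ C2 S1) => //.
  by right; rewrite h3 (le_trans h1).
by move=> s' s; have [/both[]|/ltW/both[]] := leP s' s.
Qed.

(** ** The approximation error *)

(** At the left endpoint of Q both maps agree; from there f follows its chord over
    Q, by flatness, and the interpolation follows the linear map of slope m. *)
Lemma interp_close Q s : T Q -> lo Q - len Q <= s <= hi Q + len Q ->
  enorm (f s - interp s) <= 7 * spread * len Q.
Proof.
move=> TQ sQ; have l0 := dlen_gt0 R Q; have [cl _] := core_ends TQ.
have [v fv] := T_flat TQ.
have triple : lo Q + 2 * len Q = hi Q + len Q by rewrite /dhi; ring.
rewrite triple in fv.
have H1 : enorm (f s - f (lo Q) - (s - lo Q) *: v) <= eps * len Q.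
  by apply: fv => //; apply/andP; split; rewrite /dhi; lra.
have H2 : enorm (f (hi Q) - f (lo Q) - (hi Q - lo Q) *: v) <= eps * len Q.
  by apply: fv => //; apply/andP; split; rewrite /dhi; lra.
have H3 := dev_interval TQ; have H4 := interp_dev_le s (lo Q).
rewrite /interp_dev (proj1 (interp_core cl)) in H4.
have sl : `|s - lo Q| <= 2 * len Q.
  by rewrite ler_norml; move: sQ; rewrite /dhi => /andP[a b]; apply/andP; split; lra.
pose c := (s - lo Q) / len Q.
have c2 : `|c| <= 2 by rewrite /c normrM (gtr0_norm (x := _^-1)) ?invr_gt0 // ler_pdivrMr.
have cE : s - lo Q = c * len Q by rewrite /c divfK ?gt_eqF.
have hE : hi Q - lo Q = len Q by rewrite /dhi addrC addKr.
have -> : f s - interp s =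
    (f s - f (lo Q) - (s - lo Q) *: v)
    - c *: (f (hi Q) - f (lo Q) - (hi Q - lo Q) *: v)
    + c *: (f (hi Q) - f (lo Q) - (hi Q - lo Q) *: m)
    - (interp s - f (lo Q) - (s - lo Q) *: m).
  by rewrite hE cE; apply/rowP => i; rewrite !mxE; ring.
have el : 0 <= eps * len Q by rewrite mulr_ge0 // ltW.
have S2 : enorm (c *: (f (hi Q) - f (lo Q) - (hi Q - lo Q) *: v)) <= 2 * (eps * len Q).
  by rewrite enormZ; apply: ler_pM; rewrite ?enorm_ge0.
have S3 : enorm (c *: (f (hi Q) - f (lo Q) - (hi Q - lo Q) *: m)) <= 2 * (eps * len Q).
  by rewrite enormZ; apply: ler_pM; rewrite ?enorm_ge0.
have sp : eps <= spread.
  rewrite /spread -[leLHS]mulr1 ler_wpM2l ?(ltW eps_gt0) // lerDl.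
  by have := gap_const_ge1; lra.
have sp0 : 0 <= spread by exact: le_trans (ltW eps_gt0) sp.
have H4' := le_trans H4 (ler_wpM2l sp0 sl).
have sl' : eps * len Q <= spread * len Q by rewrite ler_wpM2r // ltW.
apply: le_trans (enormB _ _) _; apply: le_trans (lerD (enormD _ _) (lexx _)) _.
apply: le_trans (lerD (lerD (enormB _ _) (lexx _)) (lexx _)) _.
apply: le_trans (lerD (lerD (lerD H1 S2) S3) H4') _.
by rewrite -mulrA; lra.
Qed.

(** The gap vanishes at the left endpoint of Q, which is a core point, and cannot
    grow by more than gap_le allows on the triple of Q. *)
Lemma interp_gap Q s : T Q -> lo Q - len Q <= s <= hi Q + len Q ->
  `|gap om f tau interp interp_lift s| <= 14 * gap_const w * spread * len Q ^+ 2.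
Proof.
move=> TQ sQ; have l0 := dlen_gt0 R Q; have [cl _] := core_ends TQ.
have [sQ1 sQ2] := andP sQ; have lh := lo_lt_hi Q.
have gap0 : gap om f tau interp interp_lift (lo Q) = 0.
  by have [E F] := interp_core cl; rewrite /gap E F (om_diag HA); ring.
have sp0 : 0 <= spread.
  by rewrite mulr_ge0 ?(ltW eps_gt0) // addr_ge0 // mulr_ge0 //; have := gap_const_ge1; lra.
have r0 : 0 <= 7 * spread * len Q by apply: mulr_ge0 (ltW l0); exact: mulr_ge0.
have G a b : a <= b -> lo Q - len Q <= a -> b <= hi Q + len Q -> b - a <= 2 * len Q ->
    `|gap om f tau interp interp_lift b - gap om f tau interp interp_lift a|
      <= 14 * gap_const w * spread * len Q ^+ 2.
  move=> ab al bh ba.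
  have := gap_le HA ab r0 f_lip interp_lip tau_hor interp_horizontal.
  move=> /(_ _)/le_trans; apply=> [x /andP[h1 h2]|].
    by apply: interp_close => //; rewrite (le_trans al) // (le_trans h2).
  have -> : 14 * gap_const w * spread * len Q ^+ 2 =
      gap_const w * (7 * spread * len Q) * (2 * len Q) by ring.
  by rewrite ler_wpM2l // mulr_ge0 //; have := gap_const_ge1; lra.
have [h|h] := lerP (lo Q) s.
  have := G _ _ h; rewrite gap0 subr0; apply; rewrite ?gerBl ?(ltW l0) //.
  by move: sQ2; rewrite /dhi; lra.
have := G _ _ (ltW h); rewrite gap0 sub0r normrN; apply=> //; move: sQ1 lh; rewrite /dhi; lra.
Qed.

End TreeApproximation.

(** * Intrinsic graphs in coordinates *)

Section Heisenberg.
Variables (R : realType) (n : nat).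
Local Notation row_t := 'rV[R]_(n + n).
Local Notation E := 'rV[R]_(n + n).-1.

Definition symp (x y : row_t) : R :=
  \sum_(i < n) (x 0 (lshift n i) * y 0 (rshift n i) - y 0 (lshift n i) * x 0 (rshift n i)).

Lemma sympDl x y z : symp (x + y) z = symp x z + symp y z.
Proof. by rewrite -big_split; apply: eq_bigr => i _; rewrite !mxE /=; ring. Qed.

Lemma sympZl a x z : symp (a *: x) z = a * symp x z.
Proof. by rewrite mulr_sumr; apply: eq_bigr => i _; rewrite !mxE /=; ring. Qed.

Lemma sympC x z : symp x z = - symp z x.
Proof. by rewrite -sumrN; apply: eq_bigr => i _; ring. Qed.

Lemma sympNl x z : symp (- x) z = - symp x z.
Proof. by rewrite -scaleN1r sympZl mulN1r. Qed.

Lemma sympDr x y z : symp z (x + y) = symp z x + symp z y.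
Proof. by rewrite sympC sympDl opprD -!sympC. Qed.

Lemma sympNr x z : symp z (- x) = - symp z x.
Proof. by rewrite sympC sympNl -sympC. Qed.

Lemma symp_le x z : `|symp x z| <= 2 * n%:R * (enorm x * enorm z).
Proof.
apply: le_trans (ler_norm_sum _ _ _) _.
apply: le_trans (_ : \sum_(i < n) 2 * (enorm x * enorm z) <= _); last first.
  by rewrite sumr_const card_ord -mulr_natl; lra.
apply: ler_sum => i _; apply: le_trans (ler_normB _ _) _; rewrite !normrM.
have H i1 i2 : `|x 0 i1| * `|z 0 i2| <= enorm x * enorm z.
  by apply: ler_pM => //; exact: coord_le_enorm.
have := H (lshift n i) (rshift n i); have := H (rshift n i) (lshift n i).
lra.
Qed.

Definition horiz (u : E) : row_t := (wpt (n := n) (u, 0)).1.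

Lemma horiz0 u (i : 'I_(n + n)) : i = 0%N :> nat -> horiz u 0 i = 0.
Proof. by move=> i0; rewrite mxE big1 // => j; rewrite i0. Qed.

Lemma horizS u (i : 'I_(n + n)) (j : 'I_(n + n).-1) : i = j.+1 :> nat -> horiz u 0 i = u 0 j.
Proof. by move=> ij; rewrite mxE (big_pred1 j) // => j'; rewrite ij eqSS. Qed.

Lemma horizD u v : horiz (u + v) = horiz u + horiz v.
Proof.
by apply/rowP => i; rewrite !mxE -big_split; apply: eq_bigr => j _; rewrite mxE.
Qed.

Lemma horizZ a u : horiz (a *: u) = a *: horiz u.
Proof.
by apply/rowP => i; rewrite !mxE mulr_sumr; apply: eq_bigr => j _; rewrite mxE.
Qed.

Lemma horizN u : horiz (- u) = - horiz u.
Proof. by rewrite -scaleN1r horizZ scaleN1r. Qed.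

Hypothesis n_gt0 : (0 < n)%N.

Lemma sum_row (F : 'I_(n + n) -> R) : exists i0 : 'I_(n + n), i0 = 0%N :> nat /\
  exists shift : 'I_(n + n).-1 -> 'I_(n + n), (forall j, shift j = j.+1 :> nat) /\
  \sum_i F i = F i0 + \sum_j F (shift j).
Proof.
have N0 : (n + n = (n + n).-1.+1)%N by lia.
have bij : bijective (cast_ord (esym N0)).
  by exists (cast_ord N0) => i; apply: val_inj.
exists (cast_ord (esym N0) ord0); split=> //.
exists (fun j => cast_ord (esym N0) (lift ord0 j)); split=> //.
by rewrite (reindex _ (onW_bij _ bij)) big_ord_recl.
Qed.

Lemma enorm_horiz u : enorm (horiz u) = enorm u.
Proof.
rewrite /enorm; have [i0 [i0E [sh [shE ->]]]] := sum_row (fun i => horiz u 0 i ^+ 2).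
rewrite horiz0 // expr0n add0r; congr Num.sqrt; apply: eq_bigr => j _.
by rewrite (@horizS u _ j).
Qed.

Lemma enorm_vpt (s : R) : enorm (vpt n s).1 = `|s|.
Proof.
rewrite /enorm; have [i0 [i0E [sh [shE ->]]]] := sum_row (fun i => (vpt n s).1 0 i ^+ 2).
rewrite mxE i0E big1 ?addr0 ?sqrtr_sqr // => j _.
by rewrite mxE shE expr0n.
Qed.

Definition first : 'I_n := Ordinal n_gt0.

Definition conj_coord (u : E) : R := horiz u 0 (rshift n first).

Lemma symp_vpt (s : R) u : symp (vpt n s).1 (horiz u) = s * conj_coord u.
Proof.
rewrite /symp (bigD1 first) //= big1 ?addr0 => [|i /eqP ni].
  by rewrite (@horiz0 u (lshift n first)) // mul0r subr0 mxE.
rewrite !mxE /=; case: eqP => [i0|_]; first by case: ni; apply: val_inj.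
by rewrite mul0r sub0r; case: eqP => [|_]; rewrite ?mulr0 ?oppr0 //; lia.
Qed.

Lemma symp_vpt2 (s s' : R) : symp (vpt n s).1 (vpt n s').1 = 0.
Proof.
rewrite /symp big1 // => i _; rewrite !mxE /=.
have -> : ((n + i)%N == 0%N) = false by apply/eqP; lia.
by rewrite !mulr0 subr0.
Qed.

Lemma conj_coord_le u : `|conj_coord u| <= enorm u.
Proof. by rewrite -enorm_horiz; exact: coord_le_enorm. Qed.

Lemma heis_area_form :
  area_form (fun u v => symp (horiz u) (horiz v)) conj_coord (2 * n%:R).
Proof.
split=> [u v z|a u z|u z|u z||u v|a u|].
- by rewrite horizD sympDl.
- by rewrite horizZ sympZl.
- exact: sympC.
- by rewrite -(enorm_horiz u) -(enorm_horiz z); exact: symp_le.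
- by rewrite mulr_ge0.
- by rewrite /conj_coord horizD mxE.
- by rewrite /conj_coord horizZ mxE.
- exact: conj_coord_le.
Qed.

(** The direction conjugate to the graph variable: moving along it changes the
    area without entering the symplectic form on the other coordinates. *)
Definition conj_dir : E := \row_j (j.+1 == n)%:R.

Lemma horiz_conj_dir (i : 'I_(n + n)) : horiz conj_dir 0 i = (i == n :> nat)%:R.
Proof.
case E : (nat_of_ord i) => [|j].
  by rewrite horiz0 //; case: n n_gt0.
have jn : (j < (n + n).-1)%N by have := ltn_ord i; rewrite E; lia.
by rewrite (@horizS _ _ (Ordinal jn)) // mxE.
Qed.

Lemma conj_coord_dir : conj_coord conj_dir = 1.
Proof. by rewrite /conj_coord horiz_conj_dir /= addn0 eqxx. Qed.

Lemma symp_conj_dir v : symp (horiz conj_dir) (horiz v) = 0.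
Proof.
rewrite /symp big1 // => i _; rewrite !horiz_conj_dir /=.
rewrite [(i : nat) == n]ltn_eqF ?ltn_ord // mul0r sub0r.
have [i0|i0] := eqVneq (i : nat) 0%N; first by rewrite horiz0 // mul0r oppr0.
have -> : ((n + i)%N == n) = false by apply/eqP; lia.
by rewrite mulr0 oppr0.
Qed.

Lemma enorm_conj_dir : enorm conj_dir = 1.
Proof.
have jn : (n.-1 < (n + n).-1)%N by lia.
rewrite /enorm (bigD1 (Ordinal jn)) //= big1 => [|j /eqP nj].
  by rewrite mxE /= prednK // eqxx expr1n addr0 sqrtr1.
rewrite mxE; have -> : (j.+1 == n) = false; last by rewrite expr0n.
by apply/eqP => jE; apply: nj; apply: val_inj => /=; lia.
Qed.

Local Notation om := (fun u v => symp (horiz u) (horiz v)).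

Lemma hnorm_vpt (s : R) : hnorm (vpt n s) = `|s|.
Proof. by rewrite /hnorm enorm_vpt normr0 sqrtr0 max_l. Qed.

Lemma hnorm_wpt (u : E) (t : R) : hnorm (wpt (n := n) (u, t)) = Num.max (enorm u) (Num.sqrt `|t|).
Proof. by rewrite /hnorm -/(horiz u) enorm_horiz. Qed.

Lemma vptB (s s' : R) : (vpt n (s - s')).1 = (vpt n s).1 - (vpt n s').1.
Proof. by apply/rowP => i; rewrite !mxE; case: eqP; rewrite ?subr0. Qed.

Lemma hmulE (p q : heis R n) : hmul p q = (p.1 + q.1, p.2 + q.2 + 2^-1 * symp p.1 q.1).
Proof. by []. Qed.

Lemma graph_mapE (f : R -> E) (tau : R -> R) (s : R) :
  graph_map (n := n) (fun x => (f x, tau x)) s =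
  ((vpt n s).1 + horiz (f s), tau s + 2^-1 * (s * conj_coord (f s))).
Proof. by rewrite /graph_map hmulE -symp_vpt /= add0r. Qed.

(** By uniqueness of the decomposition of points this computes both projections
    of the displacement between two points of a graph. *)
Lemma graph_displacement (f : R -> E) (tau : R -> R) (s s' : R) :
  let phi := (fun x => (f x, tau x)) : R -> wcoord R n in
  hmul (hinv (graph_map phi s')) (graph_map phi s) =
  hmul (vpt n (s - s')) (wpt (n := n) (f s - f s', defect om conj_coord f tau s' s)).
Proof.
rewrite /= !graph_mapE !hmulE /hinv.
rewrite -[(wpt _).1]/(horiz (f s - f s')) vptB horizD horizN.
rewrite -[(wpt _).2]/(defect _ _ _ _ _ _) -[(vpt _ _).2]/(0 : R) /defect.
rewrite [fst _]/= [snd _]/= ![(_, _).1]/= ![(_, _).2]/=; congr pair.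
  by apply/rowP => i; rewrite !mxE; ring.
rewrite !(sympDl, sympDr, sympNl, sympNr) !symp_vpt !symp_vpt2.
rewrite (sympC (horiz (f s')) (vpt n s).1) symp_vpt.
by field.
Qed.

Lemma max_sqrt_le (x t c : R) : 0 <= c ->
  (Num.max x (Num.sqrt `|t|) <= c) <-> (x <= c /\ `|t| <= c ^+ 2).
Proof.
move=> c0; rewrite ge_max; split=> [/andP[h1 h2]|[h1 h2]].
  by split=> //; rewrite -[leLHS]sqr_sqrtr // lerXn2r ?nnegrE ?sqrtr_ge0.
by rewrite h1 /= -[leRHS]ger0_norm // -(sqrtr_sqr c) ler_wsqrtr.
Qed.

Lemma intrinsic_lipschitzE (L : R) (f : R -> E) (tau : R -> R) : 0 <= L ->
  intrinsic_lipschitz L ((fun x => (f x, tau x)) : R -> wcoord R n) <->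
  elipschitz L f /\ horizontal om conj_coord (L ^+ 2) f tau.
Proof.
move=> L0; rewrite /intrinsic_lipschitz /=.
have key s s' : let p := hmul (hinv (graph_map (n := n) (fun x => (f x, tau x)) s'))
      (graph_map (n := n) (fun x => (f x, tau x)) s) in
    hnorm (piW p) <= L * hnorm (piV p) <->
    enorm (f s - f s') <= L * `|s - s'| /\
    `|defect om conj_coord f tau s' s| <= L ^+ 2 * `|s - s'| ^+ 2.
  rewrite /= ; have [-> ->] := hdecomp_uniq (graph_displacement f tau s s').
  by rewrite hnorm_vpt hnorm_wpt -exprMn; apply: max_sqrt_le; rewrite mulr_ge0.
split=> [H|[H1 H2] s s']; last by apply/key.
by split=> s s'; have /key[] := H s s' => //; have /key[] := H s' s.
Qed.

Lemma hdist_wpt (f f2 : R -> E) (tau tau2 : R -> R) (s : R) :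
  hdist (wpt (n := n) (f s, tau s)) (wpt (n := n) (f2 s, tau2 s)) =
  Num.max (enorm (f s - f2 s)) (Num.sqrt `|gap om f tau f2 tau2 s|).
Proof.
rewrite /hdist -hnorm_wpt; congr hnorm.
rewrite -[RHS]/(horiz (f s - f2 s), gap om f tau f2 tau2 s).
rewrite -[LHS]/(- horiz (f2 s) + horiz (f s),
  - tau2 s + tau s + 2^-1 * symp (- horiz (f2 s)) (horiz (f s))).
rewrite horizD horizN; congr pair; first exact: addrC.
by rewrite /gap sympNl; ring.
Qed.

End Heisenberg.

(** * The choice of the constants *)

Section LinearMap.
Variables (R : realType) (k : nat) (m : 'rV[R]_k).

Definition line_map (s : R^o) : 'rV[R]_k := (s : R) *: m.

Lemma line_map_linear : linear line_map.
Proof. by move=> a s t; rewrite /line_map scalerDl scalerA. Qed.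

HB.instance Definition _ :=
  GRing.isLinear.Build R R^o 'rV[R]_k *:%R line_map line_map_linear.

End LinearMap.

Lemma pow2_large (R : realType) (eps : R) : 0 < eps ->
  exists N : nat, 32 <= eps * (2 ^ N)%:R.
Proof.
move=> e0; exists (Num.truncn (32 / eps)).+1.
have : 32 / eps < (Num.truncn (32 / eps)).+1%:R by exact: truncnS_gt.
rewrite ltr_pdivrMr // mulrC => /ltW/le_trans; apply.
by rewrite ler_pM2l // ler_nat ltnW // ltn_expl.
Qed.

Local Notation om := (fun u v => symp (horiz u) (horiz v)).

Theorem theorem5p26 (R : realType) (n : nat) (hn : (1 < n)%N)
    (eta : R) (eta_gt0 : 0 < eta) (eta_lt1 : eta < 1) :
  exists C : R, 1 <= C /\
    forall phi : R -> wcoord R n, intrinsic_lipschitz 1 phi ->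
    exists (G B : set dyadic) (F : set (set dyadic)),
      coronization C G B F /\
      forall T : set dyadic, F T ->
      exists (LT : {linear R^o -> 'rV[R]_(n + n).-1})
             (psiT : R -> 'rV[R]_(n + n).-1) (tT : R -> R),
        let phiT : R -> wcoord R n := fun s => (LT s + psiT s, tT s) in
        [/\ elipschitz 2 LT,
            elipschitz eta psiT,
            (exists2 L : R, 0 <= L & intrinsic_lipschitz L phiT)
          & forall Q : dyadic, T Q -> forall s : R, ddouble R Q s ->
              hdist (wpt (phi s)) (wpt (phiT s)) <= eta * dlen R Q].
Proof.
have n0 : (0 < n)%N by exact: ltnW.
pose w : R := 2 * n%:R; pose c := gap_const w.
have w0 : 0 <= w by rewrite mulr_ge0.
have c1 : 1 <= c by rewrite /c /gap_const; lra.
have c0 : 0 < c by exact: lt_le_trans c1.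
have d0 : 0 < 1 + 12 * c by lra.
(* This value of eps turns the bound 14 c spread of the gap into eta ^ 2. *)
pose eps := eta ^+ 2 / (14 * c * (1 + 12 * c)).
have eps0 : 0 < eps by rewrite divr_gt0 ?exprn_gt0 // !mulr_gt0.
have spE : 14 * c * spread w eps = eta ^+ 2.
  by rewrite /spread -/c /eps; field; rewrite !gt_eqF.
have sp0 : 0 < spread w eps by rewrite mulr_gt0.
have sp_eta : 7 * spread w eps <= eta.
  have : 14 * spread w eps <= eta ^+ 2 by rewrite -spE; nra.
  nra.
have sp1 : spread w eps <= 1 by lra.
have [N N_large] := pow2_large eps0.
exists (Num.max 1 (Num.max (bad_const eps N) (corona_const eps N))).
split; first by rewrite le_max lexx.
move=> phi phi_lip; pose f s := (phi s).1; pose tau s := (phi s).2.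
have phiE : phi = (fun s => (f s, tau s)) by apply/funext => s; rewrite /f /tau; case: (phi s).
have [f_lip tau_hor] : elipschitz 1 f /\ horizontal om (conj_coord n0) 1 f tau.
  move: phi_lip; rewrite phiE => /(intrinsic_lipschitzE n0 _ _ ler01) [h1].
  by rewrite expr1n.
exists (~` bad f eps), (bad f eps), (forest f eps); split.
  by apply: (@coronization_exists _ _ f f_lip eps eps0 N N_large); rewrite !le_max lexx ?orbT.
move=> _ [P tP <-].
have HA := heis_area_form R n0; pose e := conj_dir R n.
have g_e := conj_coord_dir R n0; have om_e := symp_conj_dir (R := R) n0.
have e1 := enorm_conj_dir R n0.
have TP : tree f eps P P by have [] := tP.
have anc := @tree_anc R _ f eps P.
have chl := @tree_children R _ f eps P.
have fl := @tree_flat R _ f eps P.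
have sl := @tree_slope R _ f eps eps0 P.
pose a := interp om (conj_coord n0) e f tau (tree f eps P) P.
pose b := interp_lift om (conj_coord n0) f tau (tree f eps P) P.
have m1 := dslope_le1 f_lip P.
have adev s s' : enorm (a s - a s' - (s - s') *: dslope f P) <= spread w eps * `|s - s'|.
  exact: (interp_dev_le HA g_e om_e e1 f_lip tau_hor TP anc chl fl sl eps0).
exists (line_map (dslope f P)), (fun s => a s - s *: dslope f P), b => phiT.
have phiTE : phiT = (fun s => (a s, b s)).
  by apply/funext => s; rewrite /phiT /= /line_map addrC subrK.
split.
- move=> s s' /=; rewrite /line_map -scalerBl enormZ mulrC.
  by have := ler_wpM2r (normr_ge0 (s - s')) m1; have := normr_ge0 (s - s'); lra.
- move=> s s'; have -> : a s - s *: dslope f P - (a s' - s' *: dslope f P) =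
      a s - a s' - (s - s') *: dslope f P by apply/rowP => i; rewrite !mxE; ring.
  by apply: le_trans (adev s s') _; rewrite ler_wpM2r //; lra.
- exists (9 + 4 * w); first by lra.
  rewrite phiTE; apply/(intrinsic_lipschitzE n0); first by lra.
  have alip := interp_lip HA g_e om_e e1 f_lip tau_hor TP anc chl fl sl eps0 sp1.
  have ahor := interp_horizontal HA g_e om_e e1 f_lip tau_hor TP anc chl fl sl eps0 sp1.
  split=> s s'.
    apply: le_trans (alip s s') _; rewrite ler_wpM2r //; lra.
  apply: le_trans (ahor s s') _; rewrite ler_wpM2r ?exprn_ge0 // -/w; nra.
- move=> Q TQ s sQ; rewrite phiTE phiE hdist_wpt //.
  have l0 := dlen_gt0 R Q.
  have sQ' : dlo R Q - dlen R Q <= s <= dhi R Q + dlen R Q.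
    move: sQ; rewrite /ddouble /= in_itv /= /dhi /dlo mulrDl => /andP[h1 h2].
    by apply/andP; split; lra.
  have close := interp_close HA g_e om_e e1 f_lip tau_hor TP anc chl fl sl eps0 TQ sQ'.
  have gp := interp_gap HA g_e om_e e1 f_lip tau_hor TP anc chl fl sl eps0 sp1 TQ sQ'.
  apply/max_sqrt_le; first by rewrite mulr_ge0 // ltW.
  split; first by apply: le_trans close _; rewrite ler_wpM2r // ltW.
  by rewrite exprMn -spE.
Qed.
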